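(* Let $d\ge1$ and $\Gamma:=\{(Q,k): Q\in\mathcal{D}_d,\ 1\leq k<2^d\}$. There are positive constants $\tilde c(d)$ and $C(d)$, depending only on $d$, such that the following holds. Let $0\leq\eta\leq\tilde c(d)$ and let $\{h_{(Q),k}\}_{(Q,k)\in\Gamma}$ be the Haar functions. Suppose that, for every $(Q,k)\in\Gamma$, there are two real $d\times d$ matrices $A^{(Q),k}$ and $A^{(Q),k}_*$, and vectors $y^{(Q),k}$ and $y^{(Q),k}_*$ in $\mathbf{R}^d$, such that $$\Vert A^{(Q),k}-I_d\Vert_\infty+\Vert y^{(Q),k}\Vert_\infty\leq\eta,\qquad \Vert A^{(Q),k}_*-I_d\Vert_\infty+\Vert y^{(Q),k}_*\Vert_\infty\leq\eta.$$ For every $(Q,k)\in\Gamma$ define $$\widetilde{h_{(Q),k}}(x):=h_{(Q),k}\bigl(x_Q+A^{(Q),k}(\ell(Q)y^{(Q),k}+x-x_Q)\bigr),$$ $$h_{(Q),k}^*(x):=h_{(Q),k}\bigl(x_Q+A^{(Q),k}_*(\ell(Q)y^{(Q),k}_*+x-x_Q)\bigr).$$ Then, for any $f\in L^2(\mathbf{R}^d)$, the series $$\sum_{(Q,k)\in\Gamma}\langle f,\widetilde{h_{(Q),k}}\rangle\, h_{(Q),k}^*$$ converges unconditionally (in $L^2(\mathbf{R}^d)$) to some $f^*\in L^2(\mathbf{R}^d)$, and this $f^*$ satisfies $\Vert f-f^*\Vert_2\leq C(d)\,\eta^{1/2}\Vert f\Vert_2$.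
   Context: $\langle f,g\rangle=\int_{\mathbf{R}^d}f\overline{g}\,dx$. Dyadic cubes: a dyadic interval is an interval $[j2^n,(j+1)2^n)$ with $j,n$ integers. A cube $Q\subset\mathbf{R}^d$ is a product of $d$ half-open intervals $[a,b)$ of the same length $\ell(Q)$; $x_Q$ is its center. $Q$ is dyadic if all its factors are dyadic; $\mathcal{D}_d$ is the set of dyadic cubes in $\mathbf{R}^d$. Haar functions: for a dyadic interval $I$ with left and right halves $I_l,I_r$, $h^{(I)}:=\chi_{I_l}-\chi_{I_r}$. For $Q_0=[0,1)^d$, let $h_{(Q_0),k}$, $1\le k<2^d$, be a fixed enumeration of the $2^d-1$ functions $\prod_{i=1}^dg_i(x_i)$ where each $g_i$ is either $h^{([0,1))}$ or $\chi_{[0,1)}$ and not all $g_i$ equal $\chi_{[0,1)}$. For $Q=\prod_{i=1}^d[j_i2^n,(j_i+1)2^n)$ put $h_{(Q),k}(x_1,\dots,x_d):=2^{-nd/2}h_{(Q_0),k}(2^{-n}x_1-j_1,\dots,2^{-n}x_d-j_d)$. Norms: for a real $d\times l$ matrix $B=[b_{ij}]$, $\Vert B\Vert_\infty:=\max_{1\le i\le d}\sum_{j=1}^l|b_{ij}|$; for a (column) vector, $\Vert x\Vert_\infty=\max_i|x_i|$. $I_d$ is the $d\times d$ identity. *)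

(* Defs.v *)
From HB Require Import structures.
From mathcomp Require Import all_boot all_order all_algebra finmap.
From mathcomp Require Import all_classical all_reals all_analysis.
From mathcomp Require Import complex.
From mathcomp.analysis.showcase Require summability.

Set Implicit Arguments.
Unset Strict Implicit.
Unset Printing Implicit Defensive.

Import Order.TTheory GRing.Theory Num.Theory.
Import numFieldNormedType.Exports.

Local Open Scope classical_set_scope.
Local Open Scope ring_scope.

Section column_vectors.
Context {R : realType} {n : nat}.

Let coors : 'I_n -> 'cV[R]_n -> R := fun i x => x i 0.

Let cV_set0 : g_sigma_preimage coors set0.
Proof. exact: sigma_algebra0. Qed.

Let cV_setC A : g_sigma_preimage coors A -> g_sigma_preimage coors (~` A).
Proof. exact: sigma_algebraC. Qed.

Let cV_bigcup (F : _^nat) : (forall i, g_sigma_preimage coors (F i)) ->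
  g_sigma_preimage coors (\bigcup_i (F i)).
Proof. exact: sigma_algebra_bigcup. Qed.

(* The sigma-algebra generated by the coordinates, as for the library's
   [n.-tuple T]; over the reals it is the Borel sigma-algebra of [R^n]. *)
HB.instance Definition _ := @isMeasurable.Build
  (measure_tuple_display default_measure_display) 'cV[R]_n (g_sigma_preimage coors) cV_set0 cV_setC cV_bigcup.

End column_vectors.

Lemma measurable_coord {R : realType} {n : nat} (i : 'I_n) :
  measurable_fun [set: 'cV[R]_n] (fun x => x i 0).
Proof.
move=> _ Y mY; rewrite setTI; apply: sub_sigma_algebra => /=.
rewrite -bigcup_seq/=; exists i => /=; first by rewrite mem_index_enum.
by exists Y => //; rewrite setTI.
Qed.

Lemma measurable_fun_coordP {R : realType} {d} {T : measurableType d} {n : nat}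
    (f : T -> 'cV[R]_n) :
  (forall i, measurable_fun [set: T] (fun x => f x i 0)) ->
  measurable_fun [set: T] f.
Proof.
move=> mf.
suff H : g_sigma_preimage (fun (i : 'I_n) x => f x i 0) `<=` measurable.
  move=> _ A mA; apply: H.
  rewrite (g_sigma_preimage_comp (fun (i : 'I_n) (x : 'cV[R]_n) => x i 0)).
  by exists A.
apply: smallest_sub; first exact: sigma_algebra_measurable.
case: n => [|n] in f mf *; first by rewrite big_ord0.
rewrite -bigcup_mkord_ord; apply: bigcup_sub => i Ii.
by move=> A [B mB <-]; exact: mf.
Qed.

Section lebesgue_measure_Rn.
Context {R : realType}.

Definition vcons n (p : measurableTypeR R * 'cV[R]_n) : 'cV[R]_n.+1 :=
  \col_i if unlift ord0 i is Some j then p.2 j 0 else p.1.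

Lemma measurable_vcons n : measurable_fun setT (@vcons n).
Proof.
apply: measurable_fun_coordP => i; case: (unliftP ord0 i) => [j ij|i0].
  rewrite [X in measurable_fun _ X](_ : _ = (fun x : 'cV[R]_n => x j 0) \o snd); last first.
    by apply/funext => p; rewrite mxE ij liftK.
  exact: (measurableT_comp (measurable_coord j) measurable_snd).
rewrite [X in measurable_fun _ X](_ : _ = fst); last first.
  by apply/funext => p; rewrite mxE i0 unlift_none.
exact: measurable_fst.
Qed.

Definition vuncons n (x : 'cV[R]_n.+1) : measurableTypeR R * 'cV[R]_n :=
  (x ord0 0, \col_j x (lift ord0 j) 0).

Lemma vconsK n : cancel (@vcons n) (@vuncons n).
Proof.
move=> [t x]; rewrite /vuncons /vcons mxE unlift_none; congr pair.
by apply/colP => j; rewrite !mxE liftK.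
Qed.

Lemma measurable_vuncons n : measurable_fun setT (@vuncons n).
Proof.
apply/measurable_fun_pairP; split; first exact: measurable_coord.
apply: measurable_fun_coordP => i.
rewrite [X in measurable_fun _ X](_ : _ = fun x : 'cV[R]_n.+1 => x (lift ord0 i) 0); last first.
  by apply/funext => p; rewrite mxE.
exact: measurable_coord.
Qed.

Section step.
Context {n : nat} (mu : {sigma_finite_measure set 'cV[R]_n -> \bar R}).

Definition lebesgue_step : set 'cV[R]_n.+1 -> \bar R :=
  pushforward (lebesgue_measure \x mu)%E (@vcons n).

Let step0 : lebesgue_step set0 = 0%E.
Proof. by rewrite /lebesgue_step /pushforward preimage_set0 measure0. Qed.

Let step_ge0 A : (0 <= lebesgue_step A)%E.
Proof. by rewrite /lebesgue_step /pushforward measure_ge0. Qed.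

Let step_sigma_additive : semi_sigma_additive lebesgue_step.
Proof.
apply: (@measure_semi_sigma_additive _ _ _ (pushforward _ _)).
exact: measurable_vcons.
Qed.

HB.instance Definition _ := isMeasure.Build _ _ _ lebesgue_step
  step0 step_ge0 step_sigma_additive.

Let step_sigma_finite : sigma_finite setT lebesgue_step.
Proof.
have /sigma_finiteP[F [TF ndF Foo]] := sigma_finiteT (@lebesgue_measure R).
have /sigma_finiteP[G [TG ndG Goo]] := sigma_finiteT mu.
exists (fun k => @vuncons n @^-1` (F k `*` G k)).
  rewrite -preimage_bigcup (_ : \bigcup_k _ = setT) ?preimage_setT//.
  rewrite -setXTT TF TG predeqE => -[x y]; split.
    by move=> [k _ []/= ? ?]; split; exists k.
  move=> [/= [k _ Fkx] [l _ Gly]]; exists (maxn k l) => //; split.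
  - by move: x Fkx; exact/subsetPset/ndF/leq_maxl.
  - by move: y Gly; exact/subsetPset/ndG/leq_maxr.
move=> k; have [mF ?] := Foo k; have [mG ?] := Goo k; split.
  rewrite -[X in measurable X]setTI; apply: (@measurable_vuncons n) => //.
  exact: measurableX.
rewrite /lebesgue_step /pushforward.
rewrite (_ : _ @^-1` _ = F k `*` G k).
  by rewrite product_measure1E// lte_mul_pinfty// ge0_fin_numE.
rewrite -comp_preimage (_ : _ \o _ = id)//.
by apply/funext => p; exact: vconsK.
Qed.

HB.instance Definition _ := Measure_isSigmaFinite.Build _ _ _ lebesgue_step
  step_sigma_finite.

End step.

Fixpoint lebesgue_Rn (n : nat) :
    {sigma_finite_measure set 'cV[R]_n -> \bar R} :=
  match n with
  | 0 => \d_(0 : 'cV[R]_0)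
  | m.+1 => lebesgue_step (lebesgue_Rn m)
  end.

Lemma lebesgue_Rn_box n (a b : 'cV[R]_n) : (forall i, a i 0 <= b i 0) ->
  lebesgue_Rn n [set x | forall i, a i 0 <= x i 0 < b i 0] =
  (\prod_i (b i 0 - a i 0))%:E.
Proof.
elim: n a b => [|n IHn] a b ab.
  rewrite big_ord0 /= diracE mem_set//.
  by move=> [].
rewrite big_ord_recl /= /lebesgue_step /pushforward.
pose a' : 'cV[R]_n := \col_i a (lift ord0 i) 0.
pose b' : 'cV[R]_n := \col_i b (lift ord0 i) 0.
rewrite (_ : _ @^-1` _ = `[a ord0 0, b ord0 0[ `*`
    [set x : 'cV[R]_n | forall i, a' i 0 <= x i 0 < b' i 0]); last first.
  apply/seteqP; split => -[t x] /=.
    move=> H; split; first by have := H ord0; rewrite mxE unlift_none in_itv.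
    by move=> i; have := H (lift ord0 i); rewrite !mxE liftK.
  move=> [H1 H2] i; rewrite mxE; case: (unliftP ord0 i) => [j ->|->].
    by have := H2 j; rewrite !mxE.
  by move: H1; rewrite in_itv.
rewrite product_measure1E//; last first.
  rewrite (_ : mkset _ = \bigcap_(i in [set: 'I_n])
      ((fun x : 'cV[R]_n => x i 0) @^-1` `[a' i 0, b' i 0[)); last first.
    apply/seteqP; split => x /=.
      by move=> H i _ /=; rewrite in_itv; exact: H.
    by move=> H i; have := H i I; rewrite /= in_itv.
  apply: fin_bigcap_measurable; first exact: finite_finset.
  move=> i _; rewrite -[X in measurable X]setTI.
  by apply: measurable_coord => //.
rewrite [X in (_ * X)%E]IHn; last by move=> i; rewrite !mxE.
rewrite [X in (X * _)%E](lebesgue_measure_itv `[a ord0 0, b ord0 0[)/= lte_fin.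
have -> : (\prod_i (b' i 0 - a' i 0) =
    \prod_(i < n) (b (lift ord0 i) 0 - a (lift ord0 i) 0))%R.
  by apply: eq_bigr => i _; rewrite !mxE.
have := ab ord0; rewrite le_eqVlt => /orP[/eqP ->|->].
  by rewrite ltxx subrr mul0r mul0e.
by rewrite -EFinB -EFinM.
Qed.

End lebesgue_measure_Rn.

Section L2.
Context {R : realType} {d : nat}.
Implicit Types f g : 'cV[R]_d -> R[i].

Definition cintegral f : R[i] :=
  Complex (\int[lebesgue_Rn d]_x complex.Re (f x))
          (\int[lebesgue_Rn d]_x complex.Im (f x)).

Definition inner f g : R[i] := cintegral (fun x => f x * (g x)^*%C).

Definition norm2 f : \bar R :=
  ('N[lebesgue_Rn d]_2%:E [(fun x => (Normc.normc (f x))%:E)])%E.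

(* Elements of L^2 are represented by functions; equality in L^2 is
   [norm2 (f - g) = 0].  Since every Lebesgue measurable function is equal
   almost everywhere to a Borel one, the Borel representatives suffice. *)
Definition L2 f : Prop :=
  [/\ measurable_fun setT (fun x => complex.Re (f x)),
      measurable_fun setT (fun x => complex.Im (f x)) &
      (norm2 f < +oo)%E].

(* Unconditional convergence in L^2: the net of the partial sums over the
   finite subsets of the index set, directed by inclusion, converges. *)
Definition unconditional_sum (I : choiceType) (u : I -> 'cV[R]_d -> R[i]) f :=
  (fun J : {fset I} => norm2 (fun x => f x - \sum_(i <- J) u i x))
    @ summability.totally --> 0%E.

End L2.

(* The pair (n, j) stands for the cube [\prod_i [j_i 2^n, (j_i + 1) 2^n)]. *)
Definition dyadic_cube (d : nat) : Type := (int * 'cV[int]_d)%type.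

Section dyadic.
Context {R : realType} {d : nat}.
Implicit Type Q : dyadic_cube d.

Definition cube_side Q : R := 2 ^ Q.1.

Definition cube_set Q : set 'cV[R]_d :=
  [set x | forall i, (Q.2 i 0)%:~R * cube_side Q <= x i 0 <
                     ((Q.2 i 0)%:~R + 1) * cube_side Q].

Definition cube_center Q : 'cV[R]_d :=
  \col_i (((Q.2 i 0)%:~R + 2^-1) * cube_side Q).

(* For d > 0, a family indexed by the pairs (n, j) is a family indexed by the
   dyadic cubes. *)
Lemma cube_set_inj : (0 < d)%N -> injective cube_set.
Proof.
move=> d0 [n1 j1] [n2 j2] eqQ.
have side_gt0 Q : 0 < cube_side Q by exact: exprz_gt0.
pose s1 := cube_side (n1, j1); pose s2 := cube_side (n2, j2).
have [s1_gt0 s2_gt0] : 0 < s1 /\ 0 < s2 by split; exact: side_gt0.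
have corner Q : cube_set Q (\col_i ((Q.2 i 0)%:~R * cube_side Q)).
  by move=> i; rewrite mxE lexx/= ltr_pM2r// ltrDl.
have eqc i : (j1 i 0)%:~R * s1 = (j2 i 0)%:~R * s2.
  have := corner (n1, j1); rewrite eqQ => /(_ i) /andP[+ _].
  have := corner (n2, j2); rewrite -eqQ => /(_ i) /andP[+ _].
  by rewrite !mxE => ? ?; apply/eqP; rewrite eq_le; apply/andP.
have s_le Q Q' : cube_set Q = cube_set Q' ->
    (forall i, (Q.2 i 0)%:~R * cube_side Q = (Q'.2 i 0)%:~R * cube_side Q') ->
    cube_side Q' <= cube_side Q.
  move=> eqs eqcs; rewrite leNgt; apply/negP => lts.
  have : cube_set Q' (\col_i ((Q.2 i 0)%:~R * cube_side Q + cube_side Q)).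
    move=> i; rewrite mxE eqcs mulrDl mul1r ltrD2l lts andbT.
    by rewrite lerDl ltW.
  rewrite -eqs => /(_ (Ordinal d0)) /andP[_].
  by rewrite mxE mulrDl mul1r ltxx.
have eqs : s1 = s2.
  by apply/eqP; rewrite eq_le !s_le// => i; rewrite eqc.
have eqn : n1 = n2.
  by apply: (@ieexprIz R 2) => //; rewrite gt_eqF// ltr1n.
rewrite -eqn; congr pair; apply/colP => i.
have := eqc i; rewrite eqs => /(mulIf (lt0r_neq0 s2_gt0)).
exact: intr_inj.
Qed.

(* The function h^([0,1)). *)
Definition haar01 (t : R) : R := \1_`[0, 2^-1[ t - \1_`[2^-1, 1[ t.

(* [s i] tells whether the [i]-th factor is h^([0,1)) or chi_[0,1). *)
Definition haar_unit (s : {ffun 'I_d -> bool}) (x : 'cV[R]_d) : R :=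
  \prod_i (if s i then haar01 (x i 0) else \1_`[0, 1[ (x i 0)).

Definition haar Q (s : {ffun 'I_d -> bool}) (x : 'cV[R]_d) : R :=
  2 `^ (- (Q.1%:~R * d%:R / 2)) *
  haar_unit s (\col_i (2 ^ (- Q.1) * x i 0 - (Q.2 i 0)%:~R)).

End dyadic.

Definition haar_index (d : nat) : Type := {k : 'I_(2 ^ d) | (0 < k)%N}.

(* [e] enumerates, without repetition, the 2^d - 1 patterns for which not all
   the factors are chi_[0,1). *)
Definition haar_enumeration (d : nat) (e : haar_index d -> {ffun 'I_d -> bool}) :=
  injective e /\ forall s, (exists k, e k = s) <-> (exists i, s i).

Definition mx_norm_infty {R : realType} {m n : nat} (B : 'M[R]_(m, n)) : R :=
  \big[Num.max/0]_(i < m) \sum_(j < n) `|B i j|.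

(* [`|y|] is the library's norm on matrices, the maximum of the [`|y i 0|]. *)
Definition near_identity {R : realType} {d : nat} (eta : R)
    (A : 'M[R]_d) (y : 'cV[R]_d) : Prop :=
  mx_norm_infty (A - 1%:M) + `|y| <= eta.

Definition perturbed_haar {R : realType} {d : nat} (Q : dyadic_cube d)
    (s : {ffun 'I_d -> bool}) (A : 'M[R]_d) (y : 'cV[R]_d) (x : 'cV[R]_d) :
    R[i] :=
  (haar Q s (cube_center Q
             + A *m (cube_side Q *: y + x - cube_center Q)))%:C%C.

(* Main.v *)
(** Let g_Q = h~_Q - h_Q. Each g_Q has mean zero, is supported in 3Q, is
    bounded by 2|Q|^(-1/2), and has L^1 norm O(eta |Q|^(1/2)), as it lives in
    slabs of width O(eta l(Q)). For cubes with l(Q') = 2^(-m) l(Q), hence,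
    |<g_Q, g_Q'>| = O(eta 2^(-md/2)), and the product vanishes unless 3Q' meets
    a discontinuity of h_Q or h~_Q, which happens for O(2^(m(d-1))) cubes Q'
    only. By a weighted Schur test the Gram matrix of (g_Q) has norm O(eta), so
    (g_Q) is a Bessel sequence with constant O(eta^(1/2)). The theorem follows
    by writing f = sum <f, h> h and
    f - f^* = - sum <f, h> (h^* - h) - sum <f, h~ - h> h^*. *)

From HB Require Import structures.
Require Import Defs.
From mathcomp Require Import all_boot all_order all_algebra finmap.
From mathcomp Require Import all_classical all_reals all_analysis measurable_realfun.
From mathcomp Require Import complex ring lra zify.
From mathcomp.analysis.showcase Require summability.

Set Implicit Arguments.
Unset Strict Implicit.
Unset Printing Implicit Defensive.

Import Order.TTheory GRing.Theory Num.Theory.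
Import numFieldNormedType.Exports.

Local Open Scope classical_set_scope.
Local Open Scope ring_scope.

(** * Square-integrable functions *)

(** The exponent $1/2$ appears because $O(\eta)$ bounds the Gram matrix, that is, the square of the
    norm of the synthesis operator of $(g_Q)$. Unweighted row sums would not do: the cubes $m$
    scales below a given one contribute $2^{m(d-1)}2^{-md/2}$, which is not summable in $m$ for
    $d\ge2$. Gram entries vanish only because the mean of $g_{Q'}$ is exactly zero. The bound
    $\eta\le1/4$ makes every $A$ invertible and confines the supports to $3Q$. The expansion of $f$
    rests on two further facts. Bessel sequences with square-summable coefficients have sums in
    $L^2$, by Riesz-Fischer. And the Haar system is complete: if $r$ is orthogonal to it, the
    pairing of $r$ with the normalized indicator of a cube is $2^{-d/2}$ times that for the parent
    cube; these pairings are bounded by $\Vert r\Vert_2$, so all vanish, and a function whose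
    integral over every dyadic cube is zero vanishes almost everywhere. As the Haar functions are
    real, the work is done for real $f$ and applied to real and imaginary parts. *)

Section real_L2.
Context {d} {T : measurableType d} {R : realType}.
Variable mu : {measure set T -> \bar R}.
Implicit Types (f g h : T -> R).

Definition sqint f := f \in Lfun mu 2%:E.

Definition ip f g : R := \int[mu]_x (f x * g x).

Definition nrm f : R := Num.sqrt (ip f f).

Lemma sqint_measurable f : sqint f -> measurable_fun setT f.
Proof. by rewrite /sqint inE => /andP[/[!inE]]. Qed.

Lemma sqint_linear a f g : sqint f -> sqint g -> sqint (a *: f + g).
Proof.
have p1 : (1 <= 2%:E :> \bar R)%E by rewrite lee_fin ler1n.
by have [_] := Lfun_submod_closed mu p1; apply.
Qed.

Lemma sqint0 : sqint 0.
Proof.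
have p1 : (1 <= 2%:E :> \bar R)%E by rewrite lee_fin ler1n.
by have [] := Lfun_submod_closed mu p1.
Qed.

Lemma sqintZ a f : sqint f -> sqint (a *: f).
Proof. by move=> sf; rewrite -[_ *: _]addr0; exact: sqint_linear sqint0. Qed.

Lemma sqintD f g : sqint f -> sqint g -> sqint (f + g).
Proof. by move=> sf sg; rewrite -[f]scale1r; exact: sqint_linear. Qed.

Lemma sqintB f g : sqint f -> sqint g -> sqint (f - g).
Proof. by move=> sf sg; rewrite addrC -scaleN1r; exact: sqint_linear. Qed.

Lemma sqint_sum (I : Type) (r : seq I) (u : I -> T -> R) :
  (forall i, sqint (u i)) -> sqint (\sum_(i <- r) u i).
Proof.
move=> su; elim/big_ind: _ => //; first exact: sqint0.
by move=> f g; exact: sqintD.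
Qed.

Lemma sqint_comb (I : Type) (r : seq I) (c : I -> R) (u : I -> T -> R) :
  (forall i, sqint (u i)) -> sqint (\sum_(i <- r) c i *: u i).
Proof. by move=> su; apply: sqint_sum => i; exact: sqintZ. Qed.

Lemma sqint_integrable f g : sqint f -> sqint g ->
  mu.-integrable setT (EFin \o (fun x => f x * g x)).
Proof. by move=> sf sg; apply/Lfun1_integrable; exact: Lfun2_mul_Lfun1. Qed.

Lemma sqintP f : measurable_fun setT f ->
  (sqint f <-> (\int[mu]_x ((f x) ^+ 2)%:E < +oo)%E).
Proof.
move=> mf; split=> [sf|foo].
  have /integrableP[_] := Lfun2_integrable_sqr sf.
  by under eq_integral do rewrite /= ger0_norm ?sqr_ge0//.
rewrite /sqint inE; apply/andP; split; rewrite inE//= /finite_norm unlock.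
apply: poweR_lty; under eq_integral => x _ do
  rewrite /= powR_mulrn// real_normK ?num_real//.
exact: foo.
Qed.

Lemma ip_EFin f : sqint f ->
  (ip f f)%:E = (\int[mu]_x ((f x) ^+ 2)%:E)%E.
Proof.
move=> sf; rewrite /ip /Rintegral fineK.
  by apply: eq_integral => x _; rewrite expr2.
exact: integrable_fin_num (sqint_integrable sf sf).
Qed.

Lemma le_sqint f g : measurable_fun setT f -> sqint g ->
  (forall x, `|f x| <= `|g x|) -> sqint f.
Proof.
move=> mf sg fg; apply/sqintP => //.
have := sg; move/sqintP => /(_ (sqint_measurable sg)); apply: le_lt_trans.
have mg := sqint_measurable sg.
apply: ge0_le_integral => //.
- by move=> x _; rewrite lee_fin sqr_ge0.
- by apply/measurable_EFinP; exact: measurable_funX.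
- by apply/measurable_EFinP; exact: measurable_funX.
- by move=> x _; rewrite lee_fin -(real_normK (num_real (f x)))
    -(real_normK (num_real (g x))) lerXn2r// nnegrE.
Qed.

Lemma ipC f g : ip f g = ip g f.
Proof. by apply: eq_Rintegral => x _; rewrite mulrC. Qed.

Lemma ipDl f g h : sqint f -> sqint g -> sqint h ->
  ip (f + g) h = ip f h + ip g h.
Proof.
move=> sf sg sh; rewrite /ip -RintegralD//; try exact: sqint_integrable.
by apply: eq_Rintegral => x _; rewrite fctE mulrDl.
Qed.

Lemma ipZl a f h : sqint f -> sqint h -> ip (a *: f) h = a * ip f h.
Proof.
move=> sf sh; rewrite /ip -RintegralZl//; try exact: sqint_integrable.
by apply: eq_Rintegral => x _; rewrite fctE -mulrA.
Qed.

Lemma ip0l h : ip 0 h = 0.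
Proof.
rewrite /ip (_ : (fun x => _) = cst 0); last by apply/funext => x; rewrite mul0r.
by rewrite Rintegral_cst// mul0r.
Qed.

Lemma ipDr f g h : sqint f -> sqint g -> sqint h ->
  ip h (f + g) = ip h f + ip h g.
Proof. by move=> sf sg sh; rewrite ipC ipDl// !(ipC h). Qed.

Lemma ipZr a f h : sqint f -> sqint h -> ip h (a *: f) = a * ip h f.
Proof. by move=> sf sh; rewrite ipC ipZl// (ipC h). Qed.

Lemma ipBl f g h : sqint f -> sqint g -> sqint h ->
  ip (f - g) h = ip f h - ip g h.
Proof.
move=> sf sg sh; rewrite -scaleN1r ipDl// ?ipZl// ?mulN1r//.
exact: sqintZ.
Qed.

Lemma ip_combl (I : Type) (r : seq I) (c : I -> R) (u : I -> T -> R) h :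
  (forall i, sqint (u i)) -> sqint h ->
  ip (\sum_(i <- r) c i *: u i) h = \sum_(i <- r) c i * ip (u i) h.
Proof.
move=> su sh; elim: r => [|i r IH]; first by rewrite !big_nil ip0l.
rewrite !big_cons ipDl ?IH ?ipZl//; first exact: sqintZ.
exact: sqint_comb.
Qed.

Lemma ip_combr (I : Type) (r : seq I) (c : I -> R) (u : I -> T -> R) h :
  (forall i, sqint (u i)) -> sqint h ->
  ip h (\sum_(i <- r) c i *: u i) = \sum_(i <- r) c i * ip h (u i).
Proof.
by move=> su sh; rewrite ipC ip_combl//; apply: eq_bigr => i _; rewrite ipC.
Qed.

Lemma ip_ge0 f : 0 <= ip f f.
Proof. by apply: Rintegral_ge0 => x _; rewrite -expr2 sqr_ge0. Qed.

Lemma nrm_ge0 f : 0 <= nrm f. Proof. exact: sqrtr_ge0. Qed.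

Lemma sqr_nrm f : nrm f ^+ 2 = ip f f.
Proof. by rewrite sqr_sqrtr// ip_ge0. Qed.

(** The quadratic polynomial in [t] given by the square of [t *: g + f] is nonnegative, so its
    discriminant is not positive. *)
Lemma cauchy_schwarz f g : sqint f -> sqint g -> `|ip f g| <= nrm f * nrm g.
Proof.
move=> sf sg.
have H t : 0 <= ip f f + 2 * t * ip f g + t ^+ 2 * ip g g.
  have := ip_ge0 (t *: g + f).
  have stg := sqintZ t sg; have stgf := sqintD stg sf.
  rewrite ipDl// !ipDr// ipZl// ipZr// ipZl// ipZr// (ipC g f).
  by rewrite (_ : _ + _ = ip f f + 2 * t * ip f g + t ^+ 2 * ip g g); last ring.
rewrite -ler_sqr ?nnegrE ?mulr_ge0 ?nrm_ge0// real_normK ?num_real//.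
rewrite exprMn !sqr_nrm.
have := ip_ge0 g; rewrite le_eqVlt => /predU1P[g0|g0].
  rewrite -g0 mulr0; have [->|fg0] := eqVneq (ip f g) 0; first by rewrite expr0n.
  (* With [ip g g = 0] the polynomial is affine; this [t] would give it the value -1. *)
  have := H (- (ip f f + 1) / (2 * ip f g)); rewrite -g0 mulr0 addr0.
  rewrite (_ : 2 * _ * _ = - (ip f f + 1)); last by field.
  by lra.
have := H (- ip f g / ip g g).
rewrite (_ : _ + _ = ip f f - ip f g ^+ 2 / ip g g); last by field; rewrite gt_eqF.
by rewrite subr_ge0 ler_pdivrMr.
Qed.

Lemma nrmD f g : sqint f -> sqint g -> nrm (f + g) <= nrm f + nrm g.
Proof.
move=> sf sg; rewrite -ler_sqr ?nnegrE ?addr_ge0 ?nrm_ge0//.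
rewrite sqr_nrm ipDl ?ipDr//; try exact: sqintD.
rewrite sqrrD !sqr_nrm (ipC g f).
have := cauchy_schwarz sf sg; have := ler_norm (ip f g); lra.
Qed.

Lemma nrmN f : nrm (- f) = nrm f.
Proof. by congr Num.sqrt; apply: eq_Rintegral => x _; rewrite fctE mulrNN. Qed.

Lemma nrmB f g : nrm (f - g) = nrm (g - f).
Proof. by rewrite -opprB nrmN. Qed.

Lemma nrm_triangle f g h : sqint f -> sqint g -> sqint h ->
  nrm (f - h) <= nrm (f - g) + nrm (g - h).
Proof.
move=> sf sg sh; rewrite (_ : f - h = (f - g) + (g - h)); last by rewrite subrKA.
by apply: nrmD; exact: sqintB.
Qed.

End real_L2.

(** * Completeness of L^2 *)

Section completeness.
Context {d} {T : measurableType d} {R : realType}.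
Variable mu : {measure set T -> \bar R}.
Local Notation sqint := (sqint mu).
Local Notation nrm := (nrm mu).
Local Notation ip := (ip mu).
Implicit Types (f g h : T -> R).

Lemma sqint_abs f : sqint f -> sqint (fun x => `|f x|).
Proof.
move=> sf; apply: (le_sqint _ sf) => [|x]; last by rewrite normr_id.
by apply: measurableT_comp => //; exact: sqint_measurable sf.
Qed.

Lemma nrm_abs f : nrm (fun x => `|f x|) = nrm f.
Proof.
by congr Num.sqrt; apply: eq_Rintegral => x _; rewrite -normrM -expr2 ger0_norm ?sqr_ge0.
Qed.

Lemma nrm_sum (I : Type) (r : seq I) (u : I -> T -> R) :
  (forall i, sqint (u i)) -> nrm (\sum_(i <- r) u i) <= \sum_(i <- r) nrm (u i).
Proof.
move=> su; elim: r => [|i r IH]; first by rewrite !big_nil /nrm ip0l sqrtr0.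
rewrite !big_cons; apply: le_trans (nrmD (su i) _) _; last by rewrite lerD2l.
exact: sqint_sum.
Qed.

Lemma sum_half_lt (n m : nat) :
  \sum_(n <= k < m) (2^-1 : R) ^+ k <= 2 * 2^-1 ^+ n.
Proof.
have H k : (n <= k)%N -> \sum_(n <= k < k) (2^-1 : R) ^+ k + 2 * 2^-1 ^+ k <=
    2 * 2^-1 ^+ n.
  elim: k => [|k IH].
    by rewrite leqn0 => /eqP ->; rewrite big_geq// add0r.
  rewrite leq_eqVlt => /predU1P[->|nk]; first by rewrite big_geq// add0r.
  apply: le_trans (IH nk); rewrite big_nat_recr//= exprS mulrA divff// mul1r.
  by rewrite -addrA lerD2l; lra.
have [nm|mn] := leqP n m.
  by apply: le_trans (H m nm); rewrite lerDl mulr_ge0// exprn_ge0.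
by rewrite big_geq 1?ltnW// mulr_ge0// exprn_ge0.
Qed.

Lemma nrm_telescope (u : nat -> T -> R) : (forall n, sqint (u n)) ->
  (forall n, nrm (u n.+1 - u n) <= 2^-1 ^+ n) ->
  forall n m, (n <= m)%N -> nrm (u m - u n) <= 2 * 2^-1 ^+ n.
Proof.
move=> su hu n m nm; rewrite -(telescope_sumr u nm).
apply: le_trans (nrm_sum _ _) _ => [k|]; first exact: sqintB.
apply: le_trans (sum_half_lt n m).
by apply: ler_sum => k _; exact: hu.
Qed.

(** The partial sums of [|u n.+1 - u n|] increase and have norm at most 2, so by monotone
    convergence the limit of their squares is integrable, hence finite almost everywhere; there the
    telescoping series converges absolutely. *)
Lemma ae_cvg_telescope (u : nat -> T -> R) : (forall n, sqint (u n)) ->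
  (forall n, nrm (u n.+1 - u n) <= 2^-1 ^+ n) ->
  \forall x \ae mu, cvgn (fun n => u n x).
Proof.
move=> su hu; pose v n : T -> R := fun x => `|u n.+1 x - u n x|.
have sv n : sqint (v n) by apply: (sqint_abs (f := u n.+1 - u n)); exact: sqintB.
have nv n : nrm (v n) <= 2^-1 ^+ n by rewrite (nrm_abs (u n.+1 - u n)).
pose V N : T -> R := \sum_(0 <= n < N) v n.
have sV N : sqint (V N) by exact: sqint_sum.
have nV N : nrm (V N) <= 2.
  apply: le_trans (nrm_sum _ _) _ => //.
  rewrite -[leRHS]mulr1 -(expr0 (2^-1 : R)); apply: le_trans (sum_half_lt 0 N).
  by apply: ler_sum => n _.
have VE N x : V N x = \sum_(0 <= n < N) v n x by rewrite /V fct_sumE.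
have V0 N x : 0 <= V N x by rewrite VE sumr_ge0// => n _; exact: normr_ge0.
have ndV x : {homo (fun N => V N x) : n m / (n <= m)%N >-> n <= m}.
  apply/nondecreasing_seqP => n; rewrite !VE big_nat_recr//= lerDl.
  exact: normr_ge0.
pose g N x := ((V N x) ^+ 2)%:E.
have mg N : measurable_fun setT (g N).
  by apply/measurable_EFinP/measurable_funX; exact: (sqint_measurable (sV N)).
have g0 N x : setT x -> (0 <= g N x)%E by rewrite lee_fin sqr_ge0.
have ndg x : setT x -> {homo g^~ x : n m / (n <= m)%N >-> (n <= m)%E}.
  by move=> _ n m nm; rewrite lee_fin lerXn2r ?nnegrE// ndV.
have cg x : cvgn (g^~ x) by apply: ereal_nondecreasing_is_cvgn; exact: ndg.
have iG : mu.-integrable setT (fun x => limn (g^~ x)).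
  apply/integrableP; split.
    by apply: (emeasurable_fun_cvg g) => // x _; exact: cg.
  under eq_integral => x _.
    rewrite gee0_abs; last first.
      by apply: lime_ge; [exact: cg|apply: nearW => n; exact: g0].
    over.
  rewrite (monotone_convergence mu measurableT mg g0 ndg).
  apply: (@le_lt_trans _ _ (2 ^+ 2)%:E); last by rewrite ltry.
  apply: lime_le.
    apply: ereal_nondecreasing_is_cvgn => n m nm.
    apply: ge0_le_integral => //; by [exact: mg|move=> x xT; exact: g0|move=> x xT; exact: ndg].
  apply: nearW => n; rewrite -ip_EFin// lee_fin -sqr_nrm.
  by rewrite lerXn2r ?nnegrE ?nrm_ge0.
have := integrable_ae measurableT iG; apply: filterS => x /(_ I) Gx.
have bV N : V N x <= 1 + fine (limn (g^~ x)).
  have : (g N x <= limn (g^~ x))%E.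
    by apply: lime_ge; [exact: cg|exists N => // m /= Nm; exact: ndg].
  rewrite -(fineK Gx) lee_fin; have := V0 N x; nra.
have : cvgn (series (telescope (fun n => u n x))).
  apply: normed_cvg; rewrite (_ : [normed series _] = (fun N => V N x)); last first.
    by apply/funext => N; rewrite VE.
  apply: nondecreasing_is_cvgn; first exact: ndV.
  by exists (1 + fine (limn (g^~ x))) => _ [N _ <-].
move=> cs; rewrite (_ : (fun n => u n x) =
  (fun n => u 0%N x + series (telescope (fun n => u n x)) n)).
  by apply: is_cvgD => //; exact: is_cvg_cst.
by apply/funext => n; rewrite -(eq_sum_telescope (fun n => u n x)).
Qed.

Lemma riesz_fischer (u : nat -> T -> R) : (forall n, sqint (u n)) ->
  (forall n, nrm (u n.+1 - u n) <= 2^-1 ^+ n) ->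
  exists2 F, sqint F & forall n, nrm (F - u n) <= 2 * 2^-1 ^+ n.
Proof.
(* The upper limit is measurable and equals the limit wherever the sequence converges, so no null
   set has to be removed. *)
move=> su hu; pose F x := fine (limn_esup (fun n => (u n x)%:E)).
have mF : measurable_fun setT F.
  apply: (measurableT_comp (fine_measurable measurableT)).
  apply: measurable_fun_limn_esup => n; apply/measurable_EFinP.
  exact: sqint_measurable (su n).
have FE : \forall x \ae mu, u n x @[n --> \oo] --> F x.
  have := ae_cvg_telescope su hu; apply: filterS => x cu.
  have ce : (u n x)%:E @[n --> \oo] --> (limn (u^~ x))%:E.
    by apply: cvg_EFin; [exact: nearW|exact: cu].
  by rewrite /F (cvg_limn_einf_sup ce).2.
have E n : (\int[mu]_x ((F x - u n x) ^+ 2)%:E <= ((2 * 2^-1 ^+ n) ^+ 2)%:E)%E.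
  (* Fatou's lemma is applied to the sequence started at [n], all of whose terms have integral at
     most [(2 * 2^-1 ^+ n) ^+ 2]. *)
  pose w m x := ((u (m + n)%N x - u n x) ^+ 2)%:E.
  have mw m : measurable_fun setT (w m).
    by apply/measurable_EFinP/measurable_funX/measurable_funB; exact: sqint_measurable (su _).
  have mFu : measurable_fun setT (fun x => ((F x - u n x) ^+ 2)%:E).
    by apply/measurable_EFinP/measurable_funX/measurable_funB => //; exact: sqint_measurable (su _).
  have cw : \forall x \ae mu, w m x @[m --> \oo] --> ((F x - u n x) ^+ 2)%:E.
    apply: filterS FE => x cu; apply: cvg_EFin.
      exact: nearW.
    apply: (@continuous_cvg _ _ _ _ _ _ (fun z : R => z ^+ 2)).
      exact: exprn_continuous.
    apply: cvgB; last exact: cvg_cst.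
    by rewrite (cvg_shiftn n (fun n => u n x)).
  rewrite (@ge0_ae_eq_integral _ _ _ mu setT _ (fun x => limn_einf (w^~ x)))//.
  - apply: (le_trans (fatou mu measurableT _ _)) => //.
      by move=> m x _; rewrite lee_fin sqr_ge0.
    rewrite limn_einf_lim; apply: lime_le; first exact: is_cvg_einfs.
    apply: nearW => m; apply: le_trans (ereal_inf_lbound _) _.
      by exists m => /=.
    rewrite -(ip_EFin (f := u (m + n)%N - u n)); last exact: sqintB.
    rewrite lee_fin -sqr_nrm lerXn2r ?nnegrE ?nrm_ge0//.
    by apply: nrm_telescope => //; exact: leq_addl.
  - apply: (@eq_measurable_fun _ _ _ _ _ (fun x => - limn_esup (fun m => - w m x))%E).
      by move=> x _; rewrite limn_esupN oppeK.
    apply: measurableT_comp => //; apply: measurable_fun_limn_esup => m.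
    exact: measurableT_comp.
  - by move=> x _; rewrite lee_fin sqr_ge0.
  - move=> x _; rewrite limn_einf_lim; apply: lime_ge; first exact: is_cvg_einfs.
    by apply: nearW => m; apply: le_ereal_inf_tmp => _ [k _ <-]; rewrite lee_fin sqr_ge0.
  - by apply: filterS cw => x cw _; rewrite (cvg_limn_einf_sup cw).1.
have sFu n : sqint (F - u n).
  apply/sqintP; last by apply: le_lt_trans (E n) _; rewrite ltry.
  by apply: measurable_funB => //; exact: sqint_measurable (su _).
exists F.
  by rewrite -[F](subrK (u 0%N)); exact: sqintD.
move=> n; have := E n; rewrite -(ip_EFin (sFu n)) lee_fin -sqr_nrm.
by rewrite ler_sqr ?nnegrE ?nrm_ge0// mulr_ge0// exprn_ge0.
Qed.

End completeness.

(** * Bessel sequences and unconditional sums *)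

Section bessel.
Context {d} {T : measurableType d} {R : realType}.
Variable mu : {measure set T -> \bar R}.
Local Notation sqint := (sqint mu).
Local Notation nrm := (nrm mu).
Local Notation ip := (ip mu).
Context {I : choiceType}.
Implicit Types (f g h : T -> R) (u v : I -> T -> R) (c : I -> R) (J : {fset I}).

Definition comb J c u : T -> R := \sum_(i <- J) c i *: u i.

(** The synthesis operator is bounded here rather than the coefficients: sums of sequences then
    follow from the triangle inequality, and a Gram matrix estimate bounds the square of the left
    side. The usual inequality is [bessel_dual]. *)
Definition bessel u (b : R) := 0 <= b /\ forall J c,
  nrm (comb J c u) <= b * Num.sqrt (\sum_(i <- J) c i ^+ 2).

Lemma besselD u v b b' : (forall i, sqint (u i)) -> (forall i, sqint (v i)) ->
  bessel u b -> bessel v b' -> bessel (fun i => u i + v i) (b + b').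
Proof.
move=> su sv [b0 ub] [b'0 vb']; split=> [|J c]; first exact: addr_ge0.
rewrite /comb; under eq_bigr do rewrite scalerDr.
rewrite big_split/= mulrDl; apply: le_trans (nrmD _ _) (lerD (ub J c) (vb' J c)).
  exact: sqint_comb.
exact: sqint_comb.
Qed.

(** Testing the bound on the coefficients [ip f (u i)] themselves makes their sum of squares [S]
    equal to [ip f] of the combination, so that [S] is at most [nrm f * b] times its own square
    root, which cancels. *)
Lemma bessel_dual u b f J : (forall i, sqint (u i)) -> sqint f -> bessel u b ->
  Num.sqrt (\sum_(i <- J) ip f (u i) ^+ 2) <= b * nrm f.
Proof.
move=> su sf [b0 /(_ J (fun i => ip f (u i)))].
set S := \sum_(i <- J) _; move=> hb.
have S0 : 0 <= S by apply: sumr_ge0 => i _; rewrite sqr_ge0.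
have SE : S = ip f (comb J (fun i => ip f (u i)) u).
  by rewrite ip_combr//; apply: eq_bigr => i _; rewrite expr2.
have := cauchy_schwarz sf (sqint_comb J (fun i => ip f (u i)) su).
rewrite -/(comb _ _ _) -SE ger0_norm// -{1}(sqr_sqrtr S0).
have := sqrtr_ge0 S; rewrite le_eqVlt => /predU1P[<- _|s0].
  by rewrite mulr_ge0// nrm_ge0.
move=> h; rewrite -(ler_pM2r s0) -expr2; apply: le_trans h _.
by rewrite (mulrC b) -mulrA ler_wpM2l ?nrm_ge0.
Qed.

Lemma big_fsetD (V : zmodType) J J' (F : I -> V) : (J' `<=` J)%fset ->
  \sum_(i <- J) F i - \sum_(i <- J') F i = \sum_(i <- (J `\` J')%fset) F i.
Proof.
move=> J'J; rewrite (big_fsetID _ (fun i => i \in J'))/= [X in X + _ - _](_ : _ =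
  \sum_(i <- J') F i); last first.
  apply: congr_big => //; congr enum_fset; apply/fsetP => i; rewrite !inE/= andbC.
  by apply: andb_idr; exact: (fsubsetP J'J).
rewrite addrC addrA addNr add0r; apply: congr_big => //; congr enum_fset.
by apply/fsetP => i; rewrite !inE/= andbC.
Qed.

Lemma pow_half_lt (e : R) : 0 < e -> exists n, 2^-1 ^+ n < e.
Proof.
move=> e0; exists (Num.truncn e^-1).+1; rewrite exprVn invf_plt ?posrE ?exprn_gt0//.
apply: lt_trans (truncnS_gt _) _.
by rewrite -natrX ltr_nat ltn_expl.
Qed.

(** A finite set that nearly attains the supremum of the sums of [c i ^+ 2] leaves little for any
    finite set disjoint from it, so the net of partial sums is Cauchy. A fast Cauchy sequence
    extracted from it has a limit by [riesz_fischer], and the whole net follows. *)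
Lemma bessel_synthesis u b c K : (forall i, sqint (u i)) -> bessel u b ->
  (forall J, \sum_(i <- J) c i ^+ 2 <= K) ->
  exists2 F, sqint F & forall e, 0 < e -> exists J0, forall J,
    (J0 `<=` J)%fset -> nrm (F - comb J c u) <= e.
Proof.
move=> su [b0 ub] cK; pose A := range (fun J => \sum_(i <- J) c i ^+ 2).
have supA : has_sup A.
  by split; [exists (\sum_(i <- fset0) c i ^+ 2); exists fset0|exists K => _ [J _ <-]].
have scomb J : sqint (comb J c u) by exact: sqint_comb.
have cauchy e : 0 < e -> exists J0, forall J, (J0 `<=` J)%fset ->
    nrm (comb J c u - comb J0 c u) <= e.
  (* The divisor is [b + 1] because [b] may be zero. *)
  move=> e0; have d0 : 0 < (e / (b + 1)) ^+ 2.
    by rewrite exprn_gt0// divr_gt0// ltr_wpDl.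
  have [_ [J0 _ <-] J0S] := sup_adherent d0 supA.
  exists J0 => J J0J; rewrite /comb big_fsetD//; apply: le_trans (ub _ _) _.
  have : \sum_(i <- (J `\` J0)%fset) c i ^+ 2 <= (e / (b + 1)) ^+ 2.
    rewrite -big_fsetD//.
    have : \sum_(i <- J) c i ^+ 2 <= sup A by apply: sup_upper_bound => //; exists J.
    by move: J0S; lra.
  move=> h; apply: (@le_trans _ _ (b * (e / (b + 1)))).
    rewrite ler_wpM2l// -[leRHS]ger0_norm -?sqrtr_sqr ?ler_sqrt ?sqr_ge0//.
    by rewrite divr_ge0// ltW// ltr_wpDl.
  by rewrite mulrA ler_pdivrMr ?ltr_wpDl//; nra.
(* Consecutive index sets are compared through their union, which costs two such errors; the factor
   1/4 leaves room for both below [2^-1 ^+ n]. *)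
have q0 n : 0 < 4^-1 * (2^-1 : R) ^+ n by rewrite mulr_gt0// exprn_gt0.
have [Jn HJn] := choice (fun n => cauchy _ (q0 n)).
have step n : nrm (comb (Jn n.+1) c u - comb (Jn n) c u) <= 2^-1 ^+ n.
  have s1 := HJn n _ (fsubsetUl (Jn n) (Jn n.+1)).
  have s2 := HJn n.+1 _ (fsubsetUr (Jn n) (Jn n.+1)).
  apply: le_trans (nrm_triangle (g := comb (Jn n `|` Jn n.+1)%fset c u) _ _ _) _ => //.
  move: s1 s2; rewrite (nrmB _ (comb (Jn n.+1) c u)) exprS.
  have : 0 <= (2^-1 : R) ^+ n by rewrite exprn_ge0.
  lra.
have [F sF HF] := riesz_fischer (fun n => scomb (Jn n)) step.
exists F => // e e0.
(* The limit costs [2 * 2^-1 ^+ n] and the net a quarter of [2^-1 ^+ n], together less than three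
   times [2^-1 ^+ n]. *)
have [n hn] := pow_half_lt (divr_gt0 e0 (ltr0Sn R 2)).
exists (Jn n) => J JnJ.
apply: le_trans (nrm_triangle (g := comb (Jn n) c u) _ _ _) _ => //.
have := HF n; have := HJn n _ JnJ; rewrite (nrmB _ (comb J c u)).
have : 0 <= (2^-1 : R) ^+ n by rewrite exprn_ge0.
lra.
Qed.

End bessel.

(** * Dyadic cubes and Lebesgue measure *)

Section dyadic_geometry.
Context {R : realType} {d : nat}.
Implicit Types (Q : dyadic_cube d) (x : 'cV[R]_d).

Definition cube_coord Q x : 'cV[R]_d :=
  \col_i (2 ^ (- Q.1) * x i 0 - (Q.2 i 0)%:~R).

Lemma pow2_gt0 (n : int) : 0 < (2 : R) ^ n. Proof. exact: exprz_gt0. Qed.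

Lemma cube_setE Q x :
  cube_set Q x <-> forall i, 0 <= cube_coord Q x i 0 < 1.
Proof.
have s0 := pow2_gt0 Q.1.
suff H i : ((Q.2 i 0)%:~R * (2 : R) ^ Q.1 <= x i 0 < ((Q.2 i 0)%:~R + 1) * 2 ^ Q.1)
    = (0 <= cube_coord Q x i 0 < 1).
  by split=> h i; have := h i; rewrite /cube_side H.
by rewrite mxE -invr_expz (mulrC _ (x i 0)) subr_ge0 ler_pdivlMr// ltrBlDl ltr_pdivrMr.
Qed.

(** When [Q'] is [m] scales finer than [Q], this is its lower corner relative to that of [Q], in
    units of the side of [Q']. Being integral, it carries the nesting and counting arguments. *)
Definition cube_offset (m : nat) Q Q' : 'cV[int]_d := \col_i (Q'.2 i 0 - 2 ^+ m * Q.2 i 0).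

Lemma cube_coord_rescale (m : nat) Q Q' x : Q.1 = Q'.1 + m%:Z ->
  forall i, cube_coord Q x i 0 =
    2^-1 ^+ m * (cube_coord Q' x i 0 + (cube_offset m Q Q' i 0)%:~R).
Proof.
move=> QQ' i; rewrite !mxE QQ' opprD expfzDr// rmorphB/= rmorphM/= rmorphXn/=.
rewrite -exprnN -exprVn (_ : 2%:~R = 2 :> R)//.
have am : (2^-1 : R) ^+ m * 2 ^+ m = 1 by rewrite -exprMn mulVf// expr1n.
move: am; move: (_ ^+ m) (_ ^+ m) => b a ab; apply/eqP; rewrite -subr_eq0.
rewrite (_ : _ - _ = (a * b - 1) * (Q.2 i 0)%:~R); last by ring.
by rewrite ab subrr mul0r.
Qed.

(** Measured from the corner of [Q] in units of the finer side, each coordinate of [Q'] ranges over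
    [[p, p + 1)] and that of [Q] over [[0, 2 ^ m)]; a common point and the integrality of [p] force
    inclusion. *)
Lemma cube_set_sub Q Q' x : Q'.1 <= Q.1 ->
  cube_set Q x -> cube_set Q' x -> (@cube_set R d Q' `<=` cube_set Q).
Proof.
move=> le_n; have [m mE] : exists m : nat, Q.1 = Q'.1 + m%:Z.
  by exists `|Q.1 - Q'.1|%N; lia.
move=> /cube_setE xQ /cube_setE xQ' y /cube_setE yQ'; apply/cube_setE => i.
have {xQ} := xQ i; have {xQ'} := xQ' i; have {yQ'} := yQ' i.
rewrite !(cube_coord_rescale _ mE).
set a := cube_coord Q' y i 0; set b := cube_coord Q' x i 0.
set p : int := cube_offset _ _ _ _ _.
have h0 : 0 < (2^-1 : R) ^+ m by rewrite exprn_gt0.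
have hE u : (2^-1 : R) ^+ m * u < 1 = (u < (2 ^+ m)%:~R).
  by rewrite exprVn mulrC ltr_pdivrMr ?exprn_gt0// mul1r rmorphXn.
rewrite !hE !pmulr_rge0// => /andP[a0 a1] /andP[b0 b1] /andP[bp0 bp1].
have p0 : (-1 < p)%R by rewrite -(@ltr_int R); lra.
have p1 : p < 2 ^+ m by rewrite -(@ltr_int R); lra.
have : (0 <= p)%R by lia.
have : (p + 1 <= 2 ^+ m)%R by lia.
rewrite -!(@ler_int R) rmorphD/= => ? ?.
by apply/andP; split; lra.
Qed.

Definition cube_at (n : int) x : dyadic_cube d :=
  (n, \col_i Num.floor (2 ^ (- n) * x i 0)).

Lemma cube_atP n x : cube_set (cube_at n x) x.
Proof.
apply/cube_setE => i; rewrite !mxE/=.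
by have := floor_itv (2 ^ (- n) * x i 0); rewrite rmorphD/= subr_ge0 ltrBlDl.
Qed.

Lemma measurable_box (a b : 'cV[R]_d) :
  measurable [set x : 'cV[R]_d | forall i, a i 0 <= x i 0 < b i 0].
Proof.
rewrite (_ : mkset _ = \bigcap_(i in [set: 'I_d])
    ((fun x : 'cV[R]_d => x i 0) @^-1` `[a i 0, b i 0[)); last first.
  apply/seteqP; split => x /=.
    by move=> H i _ /=; rewrite in_itv; exact: H.
  by move=> H i; have := H i I; rewrite /= in_itv.
apply: fin_bigcap_measurable; first exact: finite_finset.
move=> i _; rewrite -[X in measurable X]setTI.
by apply: measurable_coord => //.
Qed.

Lemma measurable_cube Q : measurable (@cube_set R d Q).
Proof.
have := measurable_box (\col_i ((Q.2 i 0)%:~R * cube_side Q))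
  (\col_i (((Q.2 i 0)%:~R + 1) * cube_side Q)).
by congr measurable; apply/seteqP; split=> x /= h i; have := h i; rewrite !mxE.
Qed.

(** The empty set is added to make the family closed under intersection, as uniqueness of measures
    requires. *)
Definition dyadic_sets : set (set 'cV[R]_d) := [set set0] `|` range (@cube_set R d).

Lemma dyadic_sets_setI_closed : setI_closed dyadic_sets.
Proof.
move=> A B [->|[Q _ <-]]; first by rewrite set0I; left.
move=> [->|[Q' _ <-]]; first by rewrite setI0; left.
have [[x [xQ xQ']]|e] := pselect (exists x, cube_set Q x /\ @cube_set R d Q' x); last first.
  by left; apply/seteqP; split=> // x [? ?]; apply: e; exists x.
right; have [n|/ltW n] := leP Q.1 Q'.1.
  by exists Q => //; apply/esym/setIidl; exact: (cube_set_sub n xQ' xQ).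
by exists Q' => //; apply/esym/setIidr; exact: (cube_set_sub n xQ xQ').
Qed.

Lemma dyadic_sets_measurable : dyadic_sets `<=` measurable.
Proof. by move=> _ [->|[Q _ <-]]; [exact: measurable0|exact: measurable_cube]. Qed.

Lemma countable_dyadic_cube : countable [set: dyadic_cube d].
Proof. exact: (@countableP (int * 'cV[int]_d)%type). Qed.

(** An open half-space is the union of the dyadic cubes inside it, and there are only countably many
    cubes. *)
Lemma measurable_dyadic : @measurable _ 'cV[R]_d = <<s dyadic_sets >>.
Proof.
apply/seteqP; split; last first.
  apply: smallest_sub; first exact: sigma_algebra_measurable.
  exact: dyadic_sets_measurable.
pose T := g_sigma_algebraType dyadic_sets.
have mc (i : 'I_d) : measurable_fun setT (fun x : T => (x : 'cV[R]_d) i 0).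
  apply: (measurability _ (RGenOInfty.measurableE R)) => _ [_ [a ->] <-].
  rewrite setTI (_ : _ @^-1` _ = \bigcup_(Q : dyadic_cube d)
    (if `[< @cube_set R d Q `<=` [set x | a < x i 0] >] then cube_set Q else set0)).
    apply: countable_bigcupT_measurable; first exact: countable_dyadic_cube.
    move=> Q; case: asboolP => _; last exact: measurable0.
    by apply: sub_sigma_algebra; right; exists Q.
  apply/seteqP; split=> x /=; last first.
    by move=> [Q _]; case: asboolP => // sub /sub; rewrite in_itv/= andbT.
  rewrite in_itv/= andbT => ax.
  have [n hn] := pow_half_lt (etrans (subr_gt0 _ _) ax).
  exists (cube_at (- n%:Z) x) => //; case: asboolP => [_|]; first exact: cube_atP.
  case=> y /cube_setE/(_ i) /andP[+ _] /=; rewrite !mxE/= opprK subr_ge0.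
  have := floor_itv (2 ^ n%:Z * x i 0); rewrite rmorphD/= => /andP[_].
  move=> h1 h2; have {h1 h2} := lt_le_trans h1 (lerD h2 (lexx _)).
  move: hn; rewrite exprVn -div1r ltr_pdivrMr ?exprn_gt0//.
  have : 0 < (2 : R) ^+ n by rewrite exprn_gt0.
  rewrite -exprnP; nra.
apply: smallest_sub; first exact: (@sigma_algebra_measurable _ T).
elim/big_ind: _ => //= [A B sA sB|i _].
  by rewrite subUset.
by move=> _ [B mB <-]; exact: mc.
Qed.

Lemma dyadic_measure_unique (m1 m2 : {measure set 'cV[R]_d -> \bar R}) :
  (forall Q, m1 (cube_set Q) = m2 (cube_set Q)) ->
  (forall Q, (m1 (cube_set Q) < +oo)%E) ->
  forall A, measurable A -> m1 A = m2 A.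
Proof.
move=> m12 m1oo.
(* The unit cubes cover the space by sets of finite measure; integers that code no vector give the
   empty set. *)
pose g k : set 'cV[R]_d := if (choice.unpickle k : option 'cV[int]_d) is Some j
  then cube_set (0, j) else set0.
apply: (measure_unique dyadic_sets g measurable_dyadic dyadic_sets_setI_closed).
- by move=> k; rewrite /g; case: choice.unpickle => [j|]; [right; exists (0, j)|left].
- apply/seteqP; split=> // x _; exists (choice.pickle (cube_at 0 x).2) => //.
  by rewrite /g choice.pickleK; exact: cube_atP.
- by move=> _ [->|[Q _ <-]]; rewrite ?measure0.
- by move=> k; rewrite /g; case: choice.unpickle => [j|]; rewrite ?measure0.
Qed.

End dyadic_geometry.

(** * Change of variables under homotheties *)

Section affine_change_of_variables.
Context {R : realType} {d : nat}.
Local Notation mu := (@lebesgue_Rn R d).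

Lemma measurable_affine (B : 'M[R]_d) (v : 'cV[R]_d) :
  measurable_fun setT (fun x : 'cV[R]_d => B *m x + v).
Proof.
apply: measurable_fun_coordP => i.
rewrite (_ : (fun _ => _) = (fun x : 'cV[R]_d => \sum_j B i j * x j 0 + v i 0)).
  apply: measurable_funD => //; apply: measurable_sum => j.
  by apply: measurable_funM => //; exact: measurable_coord.
by apply/funext => x; rewrite !mxE.
Qed.

Lemma measurable_homothety (a : R) (v : 'cV[R]_d) :
  measurable_fun setT (fun x : 'cV[R]_d => a *: x + v).
Proof.
rewrite (_ : (fun _ => _) = (fun x => a%:M *m x + v)); first exact: measurable_affine.
by apply/funext => x; rewrite mul_scalar_mx.
Qed.

Lemma lebesgue_box (S : set 'cV[R]_d) (a b : 'I_d -> R) :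
  (forall x, S x <-> forall i, a i <= x i 0 < b i) -> (forall i, a i <= b i) ->
  mu S = (\prod_i (b i - a i))%:E.
Proof.
move=> SE ab; pose a' : 'cV[R]_d := \col_i a i; pose b' : 'cV[R]_d := \col_i b i.
have -> : S = [set x : 'cV[R]_d | forall i, a' i 0 <= x i 0 < b' i 0].
  by apply/seteqP; split=> x; [move/SE => h i|move=> h; apply/SE => i];
    have := h i; rewrite !mxE.
rewrite [LHS]lebesgue_Rn_box => [|i]; last by rewrite !mxE.
by congr EFin; apply: eq_bigr => i _; rewrite !mxE.
Qed.

Lemma lebesgue_cube (Q : dyadic_cube d) :
  mu (cube_set Q) = ((cube_side Q) ^+ d)%:E.
Proof.
have s0 : 0 < cube_side Q :> R := pow2_gt0 Q.1.
rewrite (@lebesgue_box _ (fun i => (Q.2 i 0)%:~R * cube_side Q)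
  (fun i => ((Q.2 i 0)%:~R + 1) * cube_side Q))// => [|i]; last first.
  by rewrite ler_pM2r// lerDl.
under eq_bigr do rewrite -mulrBl addrAC subrr add0r mul1r.
by rewrite big_const_ord iter_mulr_1.
Qed.

(** Both sides are measures in [A], and they agree on dyadic cubes, whose preimages are boxes. *)
Lemma lebesgue_homothety (a : R) (v : 'cV[R]_d) (A : set 'cV[R]_d) :
  0 < a -> measurable A ->
  mu ((fun x => a *: x + v) @^-1` A) = (((a^-1) ^+ d)%:E * mu A)%E.
Proof.
move=> a0 mA; have r0 : 0 <= (a^-1) ^+ d by rewrite exprn_ge0// invr_ge0 ltW.
have E Q : pushforward mu (fun x : 'cV[R]_d => a *: x + v) (cube_set Q) =
    mscale (NngNum r0) mu (cube_set Q).
  have s0 : 0 < cube_side Q :> R := pow2_gt0 Q.1.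
  rewrite /mscale/= [X in (_ * X)%E]lebesgue_cube /pushforward.
  rewrite [LHS](@lebesgue_box _ (fun i => ((Q.2 i 0)%:~R * cube_side Q - v i 0) / a)
    (fun i => (((Q.2 i 0)%:~R + 1) * cube_side Q - v i 0) / a)); last 2 first.
  - move=> x; split=> h i; have := h i; rewrite !mxE.
      by rewrite ler_pdivrMr// ltr_pdivlMr// lerBlDr ltrBrDr (mulrC (x i 0)).
    by rewrite ler_pdivrMr// ltr_pdivlMr// lerBlDr ltrBrDr (mulrC (x i 0)).
  - by move=> i; rewrite ler_pM2r ?invr_gt0// lerD2r ler_pM2r// lerDl.
  under eq_bigr => i _.
    rewrite (_ : _ - _ = a^-1 * cube_side Q); last by field; rewrite gt_eqF.
    over.
  by rewrite big_const_ord iter_mulr_1 exprMn EFinM.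
have mh := measurable_homothety a v.
have goo Q : (pushforward mu (fun x : 'cV[R]_d => a *: x + v)%R (cube_set Q) < +oo)%E.
  by rewrite E /mscale/= [X in (_ * X)%E]lebesgue_cube -EFinM ltry.
exact: (@dyadic_measure_unique R d
  (pushforward mu (fun x : 'cV[R]_d => a *: x + v)) (mscale (NngNum r0) mu) E _ A mA).
Qed.

Lemma ge0_integral_homothety (a : R) (v : 'cV[R]_d) (f : 'cV[R]_d -> \bar R) :
  0 < a -> measurable_fun setT f -> (forall x, 0 <= f x)%E ->
  (\int[mu]_x f (a *: x + v)%R = (a^-1 ^+ d)%:E * \int[mu]_x f x)%E.
Proof.
move=> a0 mf f0; have r0 : 0 <= (a^-1) ^+ d by rewrite exprn_ge0// invr_ge0 ltW.
have mh := measurable_homothety a v.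
have := @ge0_integral_pushforward _ _ _ _ R _ mh mu setT f measurableT mf (fun x _ => f0 x).
rewrite preimage_setT => <-.
rewrite -(ge0_integral_mscale mu measurableT (NngNum r0) mf (fun x _ => f0 x)).
apply: eq_measure_integral => A mA _; rewrite /mscale/=.
exact: lebesgue_homothety.
Qed.

Lemma integrable_homothety (a : R) (v : 'cV[R]_d) (f : 'cV[R]_d -> R) :
  0 < a -> mu.-integrable setT (EFin \o f) ->
  mu.-integrable setT (EFin \o (fun x => f (a *: x + v))).
Proof.
move=> a0 /integrableP[mf foo]; apply/integrableP; split.
  by apply: (measurableT_comp mf); exact: measurable_homothety.
rewrite (ge0_integral_homothety v (f := fun x => `|(f x)%:E|%E))//; last exact: measurableT_comp.
by rewrite lte_mul_pinfty ?lee_fin ?exprn_ge0// invr_ge0 ltW.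
Qed.

Lemma Rintegral_homothety (a : R) (v : 'cV[R]_d) (f : 'cV[R]_d -> R) :
  0 < a -> mu.-integrable setT (EFin \o f) ->
  \int[mu]_x f (a *: x + v) = a^-1 ^+ d * \int[mu]_x f x.
Proof.
move=> a0 fi; have fi' := integrable_homothety v a0 fi.
rewrite /Rintegral (_ : _ ^+ d = fine (a^-1 ^+ d)%:E)//.
rewrite -fineM//; last exact: integrable_fin_num.
congr fine; rewrite [LHS]integralE [in RHS]integralE.
have mf : measurable_fun setT (EFin \o f) by case/integrableP: fi.
rewrite muleBr//; last first.
  apply: fin_num_adde_defr; apply: integrable_fin_num => //.
  exact: integrable_funepos.
congr (_ - _)%E.
  rewrite -(ge0_integral_homothety v a0 (measurable_funepos mf))//.
  by apply: eq_integral => x _; 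
    exact: (congr1 (fun F => F x) (funepos_comp (EFin \o f) (fun x : 'cV[R]_d => a *: x + v))).
rewrite -(ge0_integral_homothety v a0 (measurable_funeneg mf))//.
  by apply: eq_integral => x _; 
    exact: (congr1 (fun F => F x) (funeneg_comp (EFin \o f) (fun x : 'cV[R]_d => a *: x + v))).
Qed.

Lemma Rintegral_translation (v : 'cV[R]_d) (f : 'cV[R]_d -> R) :
  mu.-integrable setT (EFin \o f) -> \int[mu]_x f (x + v) = \int[mu]_x f x.
Proof.
move=> fi; have := Rintegral_homothety v ltr01 fi.
by rewrite invr1 expr1n mul1r => <-; apply: eq_Rintegral => x _; rewrite scale1r.
Qed.

End affine_change_of_variables.

(** * Perturbed Haar functions at unit scale *)

Section unit_scale.
Context {R : realType} {d : nat}.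
Local Notation mu := (@lebesgue_Rn R d).
Implicit Types (s : {ffun 'I_d -> bool}) (A : 'M[R]_d) (u v w y z : 'cV[R]_d).

(* The affine map of [perturbed_haar] in the coordinates in which the cube is
   [[0, 1)^d]. *)
Definition near_affine A y u : 'cV[R]_d :=
  const_mx 2^-1 + A *m (y + u - const_mx 2^-1).

Definition perturbed_unit s A y u : R := haar_unit s (near_affine A y u).

Lemma near_affine1 u : near_affine 1%:M 0 u = u.
Proof. by rewrite /near_affine mul1mx add0r addrC subrK. Qed.

Lemma near_identity1 (eta : R) : 0 <= eta -> near_identity eta (1%:M : 'M[R]_d) 0.
Proof.
move=> e0; rewrite /near_identity subrr normr0 addr0; apply: bigmax_le => // i _.
by rewrite big1// => j _; rewrite mxE normr0.
Qed.

Section bounds.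
Variables (eta : R) (A : 'M[R]_d) (y : 'cV[R]_d).
Hypothesis near : near_identity eta A y.

Lemma near_identity_mx_norm : mx_norm_infty (A - 1%:M) <= eta.
Proof. by apply: le_trans near; rewrite lerDl. Qed.

Lemma near_identity_vec i : `|y i 0| <= eta.
Proof.
apply: le_trans (near); apply: (@le_trans _ _ `|y|).
  by rewrite [leRHS]mx_normrE; exact: (le_bigmax _ _ (i, 0)).
by rewrite lerDr; apply: bigmax_ge_id.
Qed.

Lemma near_identity_mul w (r : R) : (forall i, `|w i 0| <= r) ->
  forall i, `|(A *m w) i 0 - w i 0| <= eta * r.
Proof.
move=> wr i; have r0 : 0 <= r by apply: le_trans (wr i).
rewrite (_ : _ - _ = ((A - 1%:M) *m w) i 0); last by rewrite mulmxBl mul1mx !mxE.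
rewrite mxE; apply: le_trans (ler_norm_sum _ _ _) _.
apply: (@le_trans _ _ ((\sum_j `|(A - 1%:M) i j|) * r)).
  rewrite mulr_suml; apply: ler_sum => j _.
  by rewrite normrM ler_wpM2l.
rewrite ler_wpM2r//; apply: le_trans near_identity_mx_norm.
exact: (le_bigmax _ (fun i => \sum_j `|(A - 1%:M) i j|)).
Qed.

Lemma near_affine_close u : eta <= 1 -> (forall i, -1 <= u i 0 < 2) ->
  forall i, `|near_affine A y u i 0 - u i 0| <= 4 * eta.
Proof.
move=> e1 hu i; have yi := near_identity_vec.
(* 3/2 is the distance from the center 1/2 to the ends of [[-1, 2)]. The displacement is then at
   most [eta + eta * (eta + 3 / 2)], which is below [4 * eta]. *)
have wr j : `|(y + u - const_mx 2^-1) j 0| <= eta + 3 / 2.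
  rewrite !mxE -addrA; apply: le_trans (ler_normD _ _) _; apply: lerD => //.
  by rewrite ler_norml; have := hu j; lra.
have := near_identity_mul wr i; have := yi i.
have e0 : 0 <= eta by apply: le_trans (yi i).
rewrite /near_affine !ler_norml !mxE; set x := \sum_j _; nra.
Qed.

Lemma near_affine_lip u v (r : R) : eta <= 1 -> (forall i, `|u i 0 - v i 0| <= r) ->
  forall i, `|near_affine A y u i 0 - near_affine A y v i 0| <= 2 * r.
Proof.
move=> e1 uv i.
have r0 : 0 <= r by apply: le_trans (uv i).
have wr j : `|(u - v) j 0| <= r by rewrite !mxE.
rewrite (_ : _ - _ = (A *m (u - v)) i 0); last first.
  have -> : u - v = (y + u - const_mx 2^-1) - (y + v - const_mx 2^-1).
    by apply/colP => j; rewrite !mxE; ring.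
  by rewrite mulmxBr /near_affine !mxE; ring.
have := near_identity_mul wr i; have := wr i.
by rewrite !ler_norml !mxE; set x := \sum_j _; nra.
Qed.

(** If [m] is the largest [|w i 0|], then [m <= r + m / 4], since [A] moves each entry of [w] by at
    most [eta * m]; 4/3 is the inverse of 1 - 1/4. *)
Lemma near_identity_bounded w (r : R) : eta <= 4^-1 ->
  (forall i, `|(A *m w) i 0| <= r) -> forall i, `|w i 0| <= 4 / 3 * r.
Proof.
move=> e1 Aw i; have r0 : 0 <= r by apply: le_trans (Aw i).
pose m := \big[Num.max/0]_j `|w j 0|.
have wm j : `|w j 0| <= m by exact: (le_bigmax _ (fun j => `|w j 0|)).
have m0 : 0 <= m by apply: le_trans (wm i).
suff : m <= r + 4^-1 * m by have := wm i; lra.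
apply: bigmax_le => [|j _]; first by lra.
have := near_identity_mul wm j; have := Aw j; rewrite !ler_norml; nra.
Qed.

(** The image is within 1/2 of the center, so [y + u - 1/2] has entries at most 2/3 in absolute
    value, and [u] stays within 2/3 + 1/4 of the center. *)
Lemma near_affine_support u : eta <= 4^-1 ->
  (forall i, 0 <= near_affine A y u i 0 < 1) -> forall i, -1 <= u i 0 < 2.
Proof.
move=> e1 hz i.
have Aw j : `|(A *m (y + u - const_mx 2^-1)) j 0| <= 2^-1.
  have := hz j; rewrite mxE [X in 0 <= X + _]mxE.
  by set x := (A *m _) j 0; rewrite mxE ler_norml; lra.
have := near_identity_bounded e1 Aw i; have := near_identity_vec i.
by rewrite !mxE !ler_norml; lra.
Qed.

Lemma near_identity_unitmx : eta <= 4^-1 -> A \in unitmx.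
Proof.
move=> e1; rewrite unitmxE unitfE -det_tr; apply/det0P => -[v v0 vA].
case/negP: v0; apply/eqP/rowP => i; rewrite mxE.
have Av : A *m v^T = 0 by rewrite -[A]trmxK -trmx_mul vA trmx0.
have /(_ i) : forall i, `|v^T i 0| <= 4 / 3 * 0.
  by apply: near_identity_bounded => // j; rewrite Av mxE normr0.
by rewrite mulr0 mxE normr_le0 => /eqP.
Qed.

End bounds.

(* The discontinuities of [haar_unit s] lie on the hyperplanes where some
   coordinate is 0, 1/2 or 1. *)
Definition threshold (k : 'I_3) : R := k%:R / 2.

(** Strict comparisons are enough because every interval involved is closed on the left and open on
    the right. *)
Definition same_cell u v := forall i k,
  (u i 0 < threshold k) = (v i 0 < threshold k).

Lemma haar_unit_same_cell s u v : same_cell u v -> haar_unit s u = haar_unit s v.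
Proof.
move=> uv; apply: eq_bigr => i _.
have := uv i ord0; have := uv i (Ordinal (isT : 1 < 3)%N).
have := uv i (Ordinal (isT : 2 < 3)%N); rewrite /threshold/= mul0r divff// mul1r.
move=> h1 h2 h0; rewrite /haar01 !indicE !mem_setE !in_itv/=.
by rewrite !(leNgt _ (_ i 0)) h1 h2 h0.
Qed.

Lemma normr_haar01_le1 (t : R) : `|haar01 t| <= 1.
Proof.
rewrite /haar01 !indicE !mem_setE !in_itv/=.
by case: (_ && _); case: (_ && _);
  rewrite /= ?subrr ?subr0 ?sub0r ?normrN ?normr0 ?normr1.
Qed.

Lemma normr_haar_unit_le1 s u : `|haar_unit s u| <= 1.
Proof.
rewrite normr_prod; apply: prodr_ile1 => i _; rewrite normr_ge0/=.
case: (s i); first exact: normr_haar01_le1.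
by rewrite indicE; case: (_ \in _); rewrite ?normr0 ?normr1.
Qed.

Lemma haar_unit_support s u : haar_unit s u != 0 -> forall i, 0 <= u i 0 < 1.
Proof.
move=> h i; apply: contraNT h => ui; rewrite /haar_unit (bigD1 i)//=.
apply/eqP; rewrite [X in X * _](_ : _ = 0) ?mul0r//.
case: (s i); rewrite /haar01 !indicE !mem_setE !in_itv/=; last first.
  by move: ui => /negbTE ->.
move: ui; have [h0|h0] := leP 0 (u i 0); rewrite /= -?leNgt => h1.
  rewrite (ltNge _ 1) h1 andbF subr0 (_ : (_ < _) = false)//.
  by apply/negbTE; rewrite -leNgt; lra.
rewrite (_ : (2^-1 <= _) = false) ?subr0//.
by apply/negbTE; rewrite -ltNge; lra.
Qed.

Lemma measurable_haar_unit s : measurable_fun setT (@haar_unit R d s).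
Proof.
rewrite /haar_unit; elim: index_enum => [|i r IH].
  by under eq_fun do rewrite big_nil; exact: measurable_cst.
under eq_fun do rewrite big_cons.
apply: measurable_funM => //; case: (s i).
  apply: (measurableT_comp (f := haar01)); last exact: measurable_coord.
  by apply: measurable_funB; exact: measurable_indic.
apply: (measurableT_comp (f := (\1_`[0, 1[ : R -> R))); last exact: measurable_coord.
exact: measurable_indic.
Qed.

Lemma measurable_near_affine A y : measurable_fun setT (near_affine A y).
Proof.
rewrite (_ : near_affine A y =
  fun u => A *m u + (const_mx 2^-1 + A *m (y - const_mx 2^-1))).
  exact: measurable_affine.
apply/funext => u; rewrite /near_affine (addrC y) -addrA mulmxDr.
by rewrite addrCA.
Qed.

Lemma measurable_perturbed_unit s A y : measurable_fun setT (perturbed_unit s A y).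
Proof.
exact: (measurableT_comp (measurable_haar_unit s) (measurable_near_affine A y)).
Qed.

End unit_scale.

Section bounded_support.
Context {R : realType} {d : nat}.
Local Notation mu := (@lebesgue_Rn R d).
Implicit Types (s : {ffun 'I_d -> bool}) (A : 'M[R]_d) (u v w y z : 'cV[R]_d).

Lemma ge0_integral_le_indic (S : set 'cV[R]_d) (f : 'cV[R]_d -> R) (M : R) :
  measurable S -> measurable_fun setT f -> 0 <= M ->
  (forall x, `|f x| <= M * \1_S x) ->
  (\int[mu]_x (`|f x|)%:E <= M%:E * mu S)%E.
Proof.
move=> mS mf M0 fM.
rewrite -[X in (_ * mu X)%E]setIT -integral_indic//.
rewrite -ge0_integralZl_EFin//; last exact/measurable_EFinP/measurable_indic.
apply: ge0_le_integral => //.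
- by apply/measurable_EFinP; exact: measurableT_comp.
- by apply/measurable_EFinP; apply: measurable_funM => //; exact: measurable_indic.
- by move=> x _; rewrite -EFinM lee_fin.
Qed.

Definition support_box : set 'cV[R]_d := [set u | forall i, -1 <= u i 0 < 2].

Lemma measurable_support_box : measurable support_box.
Proof.
have := @measurable_box R d (const_mx (-1)) (const_mx 2).
by congr measurable; apply/seteqP; split=> x /= h i; have := h i; rewrite !mxE.
Qed.

Lemma lebesgue_support_box : mu support_box = (3 ^+ d)%:E.
Proof.
rewrite (@lebesgue_box _ _ _ (fun=> -1) (fun=> 2))//; last by move=> i; lra.
rewrite (eq_bigr (fun=> 3)) => [|i _]; last by lra.
by rewrite prodr_const card_ord.
Qed.

(** Mean zero is left out: of two interacting profiles only that of the smaller cube needs it, and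
    indicators of cubes also serve as profiles. *)
Definition unit_atom (M : R) (D : 'cV[R]_d -> R) :=
  measurable_fun setT D /\ forall u, `|D u| <= M * \1_support_box u.

Lemma unit_atom_ge0 M D : unit_atom M D -> 0 <= M.
Proof.
move=> [_ /(_ 0)]; rewrite indicE mem_set ?mulr1; first exact: le_trans.
by move=> i; rewrite mxE; lra.
Qed.

Lemma unit_atom_integrable M D : unit_atom M D -> mu.-integrable setT (EFin \o D).
Proof.
move=> aD; have M0 := unit_atom_ge0 aD; have [mD DM] := aD.
apply/integrableP; split; first exact/measurable_EFinP.
apply: le_lt_trans (ge0_integral_le_indic measurable_support_box mD M0 DM) _.
by rewrite [X in (_ * X)%E]lebesgue_support_box -EFinM ltry.
Qed.

Lemma unit_atom_sqint M D : unit_atom M D -> sqint mu D.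
Proof.
move=> aD; have M0 := unit_atom_ge0 aD; have [mD DM] := aD.
apply/sqintP => //.
have m2 : measurable_fun setT (fun x => D x ^+ 2) by exact: measurable_funX.
have H x : `|D x ^+ 2| <= M ^+ 2 * \1_support_box x.
  rewrite (_ : \1__ x = (\1_support_box x) ^+ 2 :> R); last first.
    by rewrite indicE; case: (_ \in _); rewrite ?expr0n ?expr1n.
  by rewrite normrX -exprMn lerXn2r ?nnegrE// mulr_ge0.
have := ge0_integral_le_indic measurable_support_box m2 (sqr_ge0 M) H.
rewrite [X in (X <= _)%E](_ : _ = (\int[mu]_x (D x ^+ 2)%:E)%E); last first.
  by apply: eq_integral => x _; rewrite ger0_norm ?sqr_ge0.
move=> /le_lt_trans; apply.
by rewrite [X in (_ * X)%E]lebesgue_support_box -EFinM ltry.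
Qed.

Lemma unit_atom_support M D u : unit_atom M D -> D u != 0 -> support_box u.
Proof.
move=> [_ /(_ u)]; rewrite indicE; have [/set_mem//|_] := boolP (u \in support_box).
by rewrite mulr0 normr_le0 => ->.
Qed.

Lemma unit_atomB M M' D D' : unit_atom M D -> unit_atom M' D' ->
  unit_atom (M + M') (fun u => D u - D' u).
Proof.
move=> [mD DM] [mD' DM']; split=> [|u]; first exact: measurable_funB.
apply: le_trans (ler_normB _ _) _; rewrite mulrDl.
exact: lerD.
Qed.

Lemma perturbed_unit_atom s eta A y : near_identity eta A y -> eta <= 4^-1 ->
  unit_atom 1 (perturbed_unit s A y).
Proof.
move=> near e1; split=> [|u]; first exact: measurable_perturbed_unit.
rewrite mul1r indicE; have [|uS] := boolP (u \in support_box).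
  by rewrite normr_haar_unit_le1.
rewrite normr_le0; apply: contraNT uS => /haar_unit_support h.
by apply: mem_set => /= i; exact: (near_affine_support near e1 h).
Qed.

Lemma haar_unit_atom s : unit_atom 1 (@haar_unit R d s).
Proof.
have := @perturbed_unit_atom s 0 _ _ (near_identity1 (lexx 0)).
rewrite (_ : perturbed_unit _ _ _ = @haar_unit R d s).
  by apply; rewrite invr_ge0.
by apply/funext => u; rewrite /perturbed_unit near_affine1.
Qed.

Lemma haar01_shift (t : R) (X := \1_`[0, 1[ : R -> R) :
  haar01 t = (X t + haar01 t) / 2 - (X (t - 2^-1) + haar01 (t - 2^-1)) / 2.
Proof.
rewrite /X /haar01 !indicE !mem_setE !in_itv/= !lerBrDr !ltrBlDr add0r.
rewrite (_ : 2^-1 + 2^-1 = 1); last by lra.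
have [h0|h0] := leP 0 t; have [h1|h1] := leP 2^-1 t; have [h2|h2] := leP 1 t;
  have [h3|h3] := ltP t (1 + 2^-1); rewrite /= ?mulr1n ?mulr0n; lra.
Qed.

(* Half of [haar_unit s' + haar_unit s] is [haar_unit s] with its [i]-th factor
   replaced by [\1_`[0, 1/2[]. Composing with an invertible affine map, the
   shift remains a translation, so translation invariance is enough to get
   mean zero: the Jacobian of the map is not needed. *)
Lemma haar_unit_shift s i (s' := [ffun j => (j != i) && s j]) z : s i ->
  haar_unit s z = (haar_unit s' z + haar_unit s z) / 2 -
    (haar_unit s' (z - 2^-1 *: delta_mx i 0) +
     haar_unit s (z - 2^-1 *: delta_mx i 0)) / 2.
Proof.
move=> si; have E s0 u : haar_unit s0 u =
    (if s0 i then haar01 (u i 0) else \1_`[0, 1[ (u i 0)) *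
    \prod_(j | j != i) (if s0 j then haar01 (u j 0) else \1_`[0, 1[ (u j 0)).
  exact: (bigD1 i).
rewrite !E !ffunE eqxx si/= !mxE !eqxx/= mulr1 {E}.
set P := \prod_(j | _) _.
rewrite [X in (_ * X + _) / 2 - _](_ : _ = P); last first.
  by apply: eq_bigr => j ji; rewrite !ffunE ji.
rewrite [X in _ - (_ * X + _) / 2](_ : _ = P); last first.
  by apply: eq_bigr => j ji; rewrite !ffunE !mxE (negbTE ji) mulr0 subr0.
rewrite [X in _ - (_ + _ * X) / 2](_ : _ = P); last first.
  by apply: eq_bigr => j ji; rewrite !mxE (negbTE ji) mulr0 subr0.
by rewrite {1}haar01_shift; ring.
Qed.

Lemma perturbed_unit_mean0 s eta A y : near_identity eta A y -> eta <= 4^-1 ->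
  (exists i, s i) -> \int[mu]_x perturbed_unit s A y x = 0.
Proof.
move=> near e1 [i si]; pose s' := [ffun j => (j != i) && s j].
(* [A] maps [v] to half the [i]-th basis vector, so translating the argument by [v] realizes the
   shift of [haar_unit_shift]. *)
pose v : 'cV[R]_d := invmx A *m (2^-1 *: delta_mx i 0).
have iS := unit_atom_integrable (perturbed_unit_atom s near e1).
have iS' := unit_atom_integrable (perturbed_unit_atom s' near e1).
pose G x := (perturbed_unit s' A y x + perturbed_unit s A y x) * 2^-1.
have iG : mu.-integrable setT (EFin \o G).
  rewrite (_ : _ \o _ = (fun x => (perturbed_unit s' A y x + perturbed_unit s A y x)%:E * (2^-1)%:E)%E)//.
  by apply: integrableZr => //; exact: (integrableD measurableT iS' iS).
have GE x : perturbed_unit s A y x = G x - G (x - v).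
  rewrite /G /perturbed_unit {1}(haar_unit_shift _ si).
  have -> // : near_affine A y (x - v) = near_affine A y x - 2^-1 *: delta_mx i 0.
  rewrite /near_affine (_ : y + (x - v) - _ = (y + x - const_mx 2^-1) - v).
    by rewrite mulmxBr [A *m v]mulKVmx ?(near_identity_unitmx near e1)// addrA.
  by apply/colP => j; rewrite !mxE; ring.
have iG' : mu.-integrable setT (EFin \o (fun x => G (x - v))).
  have := integrable_homothety (- v) ltr01 iG.
  by congr (_.-integrable _); apply/funext => x; rewrite /= scale1r.
rewrite (eq_Rintegral _ (g := fun x => G x - G (x - v))) => [|x _//].
by rewrite RintegralB// Rintegral_translation// subrr.
Qed.

(** The square of [haar01] is the indicator of [[0, 1)]. Inner products on a single cube thus reduce
    to integrals of one [haar_unit]. *)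
Lemma haar_unit_mul s s' u : haar_unit s u * haar_unit s' u =
  haar_unit [ffun i => s i (+) s' i] u.
Proof.
rewrite /haar_unit -big_split; apply: eq_bigr => i _ /=; rewrite ffunE.
move: (u i 0) => t; rewrite /haar01 !indicE !mem_setE !in_itv/=.
case: (s i); case: (s' i) => /=;
  have [h0|h0] := leP 0 t; have [h1|h1] := leP 2^-1 t; have [h2|h2] := leP 1 t;
  rewrite /= ?mulr1n ?mulr0n; lra.
Qed.

Lemma haar_unit_integral0 : \int[mu]_x haar_unit [ffun=> false] x = 1.
Proof.
pose Q : dyadic_cube d := (0, 0).
have QE : @cube_set R d Q = [set u | forall i, 0 <= u i 0 < 1].
  apply/seteqP; split=> u; rewrite /cube_set/= /cube_side/= => h i; have := h i;
    by rewrite mxE mul0r add0r mul1r.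
have -> : (fun x : 'cV[R]_d => haar_unit [ffun=> false] x) = \1_(cube_set Q).
  apply/funext => u; rewrite indicE /haar_unit; case: (boolP (u \in cube_set Q)).
    rewrite inE QE => h; rewrite big1// => i _; rewrite ffunE indicE mem_setE in_itv/=.
    by rewrite h.
  rewrite notin_setE QE => h; apply/eqP; apply: contra_notT h => p i.
  exact: haar_unit_support p i.
rewrite /Rintegral integral_indic//; last exact: measurable_cube.
by rewrite setIT [X in fine X]lebesgue_cube /cube_side/= expr1n.
Qed.

End bounded_support.

(** * L^1 size of the perturbation *)

Section perturbation_L1.
Context {R : realType} {d : nat}.
Local Notation mu := (@lebesgue_Rn R d).
Implicit Types (s : {ffun 'I_d -> bool}) (A : 'M[R]_d) (u v w y z : 'cV[R]_d).

(* A point where the perturbed function differs from the original one has a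
   coordinate within [4 * eta] of a threshold. *)
Definition slab (eta : R) (p : 'I_d * 'I_3) : set 'cV[R]_d :=
  [set u | forall j, (if j == p.1 then threshold p.2 - 4 * eta else -1) <= u j 0 <
                     (if j == p.1 then threshold p.2 + 4 * eta else 2)].

Lemma measurable_slab eta p : measurable (slab eta p).
Proof.
have := measurable_box
  (\col_j (if j == p.1 then threshold p.2 - 4 * eta else -1) : 'cV[R]_d)
  (\col_j (if j == p.1 then threshold p.2 + 4 * eta else 2)).
by congr measurable; apply/seteqP; split=> x /= h i; have := h i; rewrite !mxE.
Qed.

Lemma lebesgue_slab eta p : 0 <= eta -> mu (slab eta p) = (8 / 3 * eta * 3 ^+ d)%:E.
Proof.
move=> e0; rewrite (@lebesgue_box _ _ _ _ _ (fun x => iff_refl _))//; last first.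
  by move=> j; case: ifP => _; lra.
rewrite (eq_bigr (fun j => (if j == p.1 then 8 / 3 * eta else 1) * 3)); last first.
  by move=> j _; case: ifP => _; lra.
by rewrite big_split/= -big_mkcond big_pred1_eq prodr_const card_ord.
Qed.

(** The number [3 * d] of slabs, times the bound 2 for the perturbation, times the volume
    [8 / 3 * 3 ^+ d] of a slab per unit of [eta]. *)
Definition perturbation_constant : R := 16 * d%:R * 3 ^+ d.

Definition perturbation s A y u : R := perturbed_unit s A y u - haar_unit s u.

Section near.
Variables (s : {ffun 'I_d -> bool}) (eta : R) (A : 'M[R]_d) (y : 'cV[R]_d).
Hypotheses (near : near_identity eta A y) (e1 : eta <= 4^-1).

Lemma perturbation_atom : unit_atom 2 (perturbation s A y).
Proof. exact: unit_atomB (perturbed_unit_atom s near e1) (haar_unit_atom s). Qed.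

Lemma perturbation_mean0 : (exists i, s i) -> \int[mu]_x perturbation s A y x = 0.
Proof.
move=> si; have e0 : 0 <= eta by case: si => i _; apply: le_trans (near_identity_vec near i).
rewrite RintegralB//; try exact: unit_atom_integrable (perturbed_unit_atom s near e1).
  rewrite (perturbed_unit_mean0 near e1 si) sub0r.
  under eq_Rintegral do rewrite -[X in haar_unit s X]near_affine1.
  by rewrite (perturbed_unit_mean0 (near_identity1 e0) e1 si) oppr0.
exact: unit_atom_integrable (haar_unit_atom s).
Qed.

Lemma perturbation_L1 :
  (\int[mu]_x (`|perturbation s A y x|)%:E <= (perturbation_constant * eta)%:E)%E.
Proof.
(* For [d = 0] there is no coordinate from which to read off [0 <= eta], but then the perturbation
   vanishes. *)
have [d0|[i0 _]] : d = 0%N \/ exists i : 'I_d, True.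
  by case: (d) => [|n]; [left|right; exists ord0].
  rewrite (_ : (fun x => _) = cst 0%E) ?integral0; last first.
    apply/funext => x; rewrite /perturbation /perturbed_unit (_ : near_affine A y x = x) ?subrr ?normr0//.
    by apply/colP => i; exfalso; case: i; rewrite d0.
  by rewrite lee_fin /perturbation_constant d0 mulr0 !mul0r.
have e0 : 0 <= eta by apply: le_trans (near_identity_vec near i0).
have [mD DM] := perturbation_atom.
have ptw u : `|perturbation s A y u| <= \sum_p 2 * \1_(slab eta p) u.
  have S0 : 0 <= \sum_p 2 * \1_(slab eta p) u :> R.
    by apply: sumr_ge0 => p _; rewrite mulr_ge0.
  have [uB|uB] := boolP (u \in support_box); last first.
    by apply: le_trans (DM u) _; rewrite indicE (negbTE uB) mulr0.
  (* In one cell both functions agree. Otherwise threshold [k] separates the [i]-th coordinates of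
     [u] and its image, which are [4 * eta] close, so [u] is in a slab. *)
  have [sc|/existsNP[i /existsNP[k ik]]] := pselect (same_cell u (near_affine A y u)).
    rewrite /perturbation /perturbed_unit (haar_unit_same_cell s sc).
    by rewrite subrr normr0.
  have us : u \in slab eta (i, k).
    apply: mem_set => j /=; case: eqP => [->|_]; last by move: uB; rewrite inE.
    move: uB; rewrite inE => uB.
    have := near_affine_close near (le_trans e1 _) uB i; rewrite invf_le1 ?ler1n// => /(_ isT).
    rewrite ler_norml; move: ik.
    have [h1|h1] := ltP (u i 0) (threshold k);
      have [h2|h2] := ltP (near_affine A y u i 0) (threshold k) => // _; lra.
  apply: (@le_trans _ _ 2).
    by apply: le_trans (DM u) _; rewrite indicE; case: (_ \in _); rewrite ?mulr1 ?mulr0.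
  rewrite (bigD1 (i, k))//= indicE us mulr1 lerDl.
  by apply: sumr_ge0 => p _; rewrite mulr_ge0.
apply: (@le_trans _ _ (\int[mu]_x (\sum_p 2 * \1_(slab eta p) x)%:E)%E).
  apply: ge0_le_integral => //.
  - by apply/measurable_EFinP; exact: measurableT_comp.
  - apply/measurable_EFinP; apply: measurable_sum => p.
    by apply: measurable_funM => //; apply: measurable_indic; exact: measurable_slab.
  - by move=> x _; rewrite lee_fin.
under eq_integral do rewrite -sumEFin.
rewrite ge0_integral_sum//; last first.
  move=> p; apply/measurable_EFinP.
  by apply: measurable_funM => //; apply: measurable_indic; exact: measurable_slab.
rewrite (eq_bigr (fun=> (16 / 3 * eta * 3 ^+ d)%:E)) => [|p _]; last first.
  under eq_integral do rewrite EFinM.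
  rewrite ge0_integralZl_EFin//; last first.
    apply/measurable_EFinP.
    by apply: measurable_indic; exact: measurable_slab.
  rewrite integral_indic//; last exact: measurable_slab.
  by rewrite setIT [X in (_ * X)%E]lebesgue_slab// -EFinM; congr EFin; lra.
rewrite sumEFin lee_fin sumr_const card_prod !card_ord -[X in X <= _]mulr_natr natrM.
by rewrite /perturbation_constant le_eqVlt; apply/orP; left; apply/eqP; field.
Qed.

End near.

End perturbation_L1.

(** * Rescaling to an arbitrary cube *)

Section scaled_atoms.
Context {R : realType} {d : nat}.
Local Notation mu := (@lebesgue_Rn R d).
Implicit Types (Q : dyadic_cube d) (D : 'cV[R]_d -> R).

Lemma cube_side_gt0 Q : 0 < cube_side Q :> R. Proof. exact: pow2_gt0. Qed.

Lemma cube_coordE Q x :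
  cube_coord Q x = (cube_side Q)^-1 *: x + - map_mx intr Q.2 :> 'cV[R]_d.
Proof. by apply/colP => i; rewrite !mxE invr_expz. Qed.

(** This is $|Q|^{-1/2}$, the factor with which passing from the unit cube to [Q] preserves inner
    products. *)
Definition cube_weight Q : R := Num.sqrt ((cube_side Q)^-1 ^+ d).

Lemma cube_weight_ge0 Q : 0 <= cube_weight Q. Proof. exact: sqrtr_ge0. Qed.

Lemma cube_weight_sqr Q : cube_weight Q ^+ 2 * cube_side Q ^+ d = 1.
Proof.
have s0 := cube_side_gt0 Q.
rewrite sqr_sqrtr ?exprn_ge0 ?invr_ge0 ?ltW// -exprMn mulVf ?gt_eqF//.
exact: expr1n.
Qed.

Definition atom Q D (x : 'cV[R]_d) : R := cube_weight Q * D (cube_coord Q x).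

Lemma measurable_atom Q D : measurable_fun setT D -> measurable_fun setT (atom Q D).
Proof.
move=> mD; apply: measurable_funM => //; apply: (measurableT_comp mD).
rewrite (_ : cube_coord Q = fun x => (cube_side Q)^-1 *: x + - map_mx intr Q.2).
  exact: measurable_homothety.
by apply/funext => x; rewrite cube_coordE.
Qed.

Lemma integrable_cube_coord Q D : mu.-integrable setT (EFin \o D) ->
  mu.-integrable setT (EFin \o (fun x => D (cube_coord Q x))).
Proof.
move=> iD; have s0 := cube_side_gt0 Q.
have := integrable_homothety (- map_mx intr Q.2) (etrans (invr_gt0 _) s0) iD.
by congr (_.-integrable _); apply/funext => x; rewrite /= cube_coordE.
Qed.

Lemma Rintegral_cube_coord Q D : mu.-integrable setT (EFin \o D) ->
  \int[mu]_x D (cube_coord Q x) = cube_side Q ^+ d * \int[mu]_x D x.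
Proof.
move=> iD; have s0 := cube_side_gt0 Q.
have := Rintegral_homothety (- map_mx intr Q.2) (etrans (invr_gt0 _) s0) iD.
rewrite invrK => <-; by apply: eq_Rintegral => x _; rewrite cube_coordE.
Qed.

Lemma integrable_scale k D : mu.-integrable setT (EFin \o D) ->
  mu.-integrable setT (EFin \o (fun x => k * D x)).
Proof. by move=> iD; exact: (integrableZl measurableT k iD). Qed.

Lemma atom_integrable Q D : mu.-integrable setT (EFin \o D) ->
  mu.-integrable setT (EFin \o atom Q D).
Proof. by move=> iD; apply: integrable_scale; exact: integrable_cube_coord. Qed.

Lemma Rintegral_atom Q D : mu.-integrable setT (EFin \o D) ->
  \int[mu]_x atom Q D x = cube_weight Q * cube_side Q ^+ d * \int[mu]_x D x.
Proof.
move=> iD; rewrite RintegralZl//; last exact: integrable_cube_coord.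
by rewrite Rintegral_cube_coord// mulrA.
Qed.

Lemma atom_sqint M Q D : unit_atom M D -> sqint mu (atom Q D).
Proof.
move=> aD; have [mD _] := aD; apply/sqintP; first exact: measurable_atom.
have i2 := integrable_cube_coord Q (Lfun2_integrable_sqr (unit_atom_sqint aD)).
have /integrableP[_] := integrable_scale (cube_weight Q ^+ 2) i2.
apply: le_lt_trans; rewrite le_eqVlt; apply/orP; left; apply/eqP.
by apply: eq_integral => x _; 
  rewrite /= -exprMn ger0_norm ?sqr_ge0.
Qed.

Lemma ip_atom M M' Q D D' : unit_atom M D -> unit_atom M' D' ->
  ip mu (atom Q D) (atom Q D') = \int[mu]_x (D x * D' x).
Proof.
move=> aD aD'; have i2 := sqint_integrable (unit_atom_sqint aD) (unit_atom_sqint aD').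
rewrite /ip (eq_Rintegral _
  (g := fun x => cube_weight Q ^+ 2 * (D (cube_coord Q x) * D' (cube_coord Q x)))).
  rewrite RintegralZl//; last exact: (integrable_cube_coord Q i2).
  by rewrite (Rintegral_cube_coord Q i2) mulrA cube_weight_sqr mul1r.
by move=> x _; rewrite /atom; ring.
Qed.

(** The constant leaves the integral, and the mean zero of [D'] remains. This gives both the
    vanishing Gram entries and the orthogonality of Haar functions on different cubes. *)
Lemma ip_atom_const M Q Q' D D' c : unit_atom M D' -> \int[mu]_x D' x = 0 ->
  (forall x, D' (cube_coord Q' x) != 0 -> D (cube_coord Q x) = c) ->
  ip mu (atom Q D) (atom Q' D') = 0.
Proof.
move=> aD' D'0 Dc; have iD' := unit_atom_integrable aD'.
rewrite /ip (eq_Rintegral _ (g := fun x => cube_weight Q * c * atom Q' D' x)).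
  by rewrite RintegralZl ?Rintegral_atom ?D'0 ?mulr0//; exact: atom_integrable.
move=> x _; rewrite /atom.
by have [->|/Dc ->//] := eqVneq (D' (cube_coord Q' x)) 0; rewrite !mulr0.
Qed.

Definition rho : R := Num.sqrt 2^-1.

Lemma rho_sqr : rho ^+ 2 = 2^-1. Proof. by rewrite sqr_sqrtr// invr_ge0. Qed.

Lemma rho_gt0 : 0 < rho. Proof. by rewrite sqrtr_gt0 invr_gt0. Qed.

Lemma cube_weight_rescale (m : nat) Q Q' : Q.1 = Q'.1 + m%:Z ->
  cube_weight Q * (cube_weight Q' * cube_side Q' ^+ d) = rho ^+ (m * d).
Proof.
move=> QQ'; have s0 := cube_side_gt0 Q; have s'0 := cube_side_gt0 Q'.
have sE : cube_side Q = 2 ^+ m * cube_side Q' :> R.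
  by rewrite /cube_side QQ' expfzDr// mulrC.
apply/eqP; rewrite -(@eqrXn2 _ 2)//; last 2 first.
- by rewrite !mulr_ge0 ?cube_weight_ge0 ?exprn_ge0// ltW.
- by rewrite exprn_ge0// ltW// rho_gt0.
rewrite exprAC rho_sqr !exprMn mulrA; apply/eqP.
rewrite ![cube_weight _ ^+ 2]sqr_sqrtr ?exprn_ge0 ?invr_ge0 ?ltW//.
rewrite expr2 -!exprMn exprM; congr (_ ^+ d); rewrite sE exprVn.
by field; rewrite expf_neq0// gt_eqF.
Qed.

(** The supremum of the larger atom times the L^1 norm of the smaller one; the normalizations
    combine to $|Q|^{-1/2}|Q'|^{1/2}=2^{-md/2}$. *)
Lemma ip_atom_le M M' (m : nat) Q Q' D D' (L : R) : unit_atom M D -> unit_atom M' D' ->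
  Q.1 = Q'.1 + m%:Z -> (\int[mu]_x (`|D' x|)%:E <= L%:E)%E ->
  `|ip mu (atom Q D) (atom Q' D')| <= M * L * rho ^+ (m * d).
Proof.
move=> aD aD' QQ' D'L; have iD' := unit_atom_integrable aD'.
have iabs : mu.-integrable setT (EFin \o (fun x => `|D' x|)).
  exact: (integrable_norm iD').
have i2 := sqint_integrable (atom_sqint Q aD) (atom_sqint Q' aD').
apply: le_trans (le_normr_Rintegral measurableT i2) _.
have DM u : `|D u| <= M.
  have [_ /(_ u)] := aD; move=> /le_trans; apply.
  by rewrite ler_piMr ?(unit_atom_ge0 aD)// indicE; case: (_ \in _).
apply: (@le_trans _ _ (\int[mu]_x (cube_weight Q * M * atom Q' (fun x => `|D' x|) x))).
  apply: le_Rintegral => //.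
  - exact: (integrable_norm i2).
  - by apply: integrable_scale; exact: atom_integrable.
  - move=> x _; rewrite normrM /atom normrM (ger0_norm (cube_weight_ge0 _)).
    rewrite ler_pM// ?mulr_ge0 ?cube_weight_ge0//.
      by rewrite ler_wpM2l ?cube_weight_ge0.
    by rewrite normrM (ger0_norm (cube_weight_ge0 _)).
rewrite RintegralZl//; last exact: atom_integrable.
rewrite Rintegral_atom// -(cube_weight_rescale QQ').
have : \int[mu]_x `|D' x| <= L.
  rewrite -lee_fin; apply: le_trans D'L.
  by rewrite /Rintegral fineK//; exact: (integrable_fin_num measurableT iabs).
set J := \int[mu]_x _ => JL.
rewrite (_ : _ * _ = M * (cube_weight Q * (cube_weight Q' * cube_side Q' ^+ d)) * J); last by ring.
rewrite (_ : M * L * _ = M * (cube_weight Q * (cube_weight Q' * cube_side Q' ^+ d)) * L); last by ring.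
rewrite ler_wpM2l// !mulr_ge0 ?cube_weight_ge0 ?(unit_atom_ge0 aD)//.
by rewrite exprn_ge0// ltW// cube_side_gt0.
Qed.

Lemma haar_normalization Q : 2 `^ (- (Q.1%:~R * d%:R / 2)) = cube_weight Q.
Proof.
rewrite -mulNr powRrM powR12_sqrt ?powR_ge0// /cube_weight /cube_side.
congr Num.sqrt; rewrite -mulNr -mulrNz -[d%:R]/(d%:Z%:~R) -intrM powR_intmul//.
by rewrite invr_expz -exprz_exp.
Qed.

(** Since [y] is multiplied by the side of [Q], the affine perturbation is compatible with
    rescaling, and every cube inherits the estimates of the unit cube. *)
Lemma perturbed_haarE Q s A y x :
  perturbed_haar Q s A y x = (atom Q (perturbed_unit s A y) x)%:C%C.
Proof.
have s0 := cube_side_gt0 Q.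
rewrite /perturbed_haar /haar /atom haar_normalization /perturbed_unit.
congr ((_ * haar_unit _ _)%:C%C).
have cE : (cube_side Q)^-1 *: (@cube_center R d Q) = map_mx intr Q.2 + const_mx 2^-1.
  by apply/colP => i; rewrite !mxE mulrC mulfK ?gt_eqF.
transitivity ((cube_side Q)^-1 *: (cube_center Q + A *m (cube_side Q *: y + x - cube_center Q))
   - map_mx intr Q.2); first by apply/colP => i; rewrite !mxE invr_expz.
rewrite scalerDr cE /near_affine cube_coordE addrAC [_ + const_mx _]addrC addrK.
congr (_ + _); rewrite scalemxAr; congr (_ *m _).
by rewrite scalerBr scalerDr scalerA mulVf ?gt_eqF// scale1r cE opprD !addrA.
Qed.

End scaled_atoms.

(** * Almost orthogonality of the perturbations *)

Section schur_test.
Context {R : realType} {I : choiceType} (d : nat).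
Local Notation rho := (@rho R).
Implicit Types (J : {fset I}) (c : I -> R).

Lemma rho_le : rho <= 3 / 4.
Proof.
rewrite -ler_sqr ?nnegrE ?divr_ge0 ?(ltW (@rho_gt0 R))//.
by rewrite rho_sqr expr2; lra.
Qed.

Lemma sum_rho_le (M : nat) : \sum_(m < M) rho ^+ m <= 4.
Proof.
have H : \sum_(m < M) rho ^+ m + 4 * (3 / 4) ^+ M <= 4.
  elim: M => [|M IH]; first by rewrite big_ord0 add0r expr0 mulr1.
  rewrite big_ord_recr/= exprS.
  have : rho ^+ M <= (3 / 4) ^+ M.
    by rewrite lerXn2r ?rho_le// nnegrE ?divr_ge0// ltW ?rho_gt0.
  by move: IH; lra.
by apply: le_trans H; rewrite lerDl mulr_ge0// exprn_ge0// divr_ge0.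
Qed.

(* Splits an off-diagonal Gram bound [rho ^ (m d) |a| |b|] between the two
   coefficients so that both resulting series in [m] are geometric: there are
   [O(2 ^ (m (d - 1))) = O(rho ^ (- 2 m (d - 1)))] partners [m] scales below
   a given cube, but only [O(1)] partners [m] scales above it. *)
Lemma weighted_amgm (a b t : R) : (0 < d)%N -> 0 <= t ->
  2 * (a * b * t ^+ d) <= a ^+ 2 * t ^+ (2 * d).-1 + b ^+ 2 * t.
Proof.
case: d => // k _ t0; rewrite (_ : (2 * k.+1).-1 = (k + k).+1)%N; last by lia.
rewrite !exprS exprD; set x := t ^+ k.
have : 0 <= t * (a * x - b) ^+ 2 by rewrite mulr_ge0// sqr_ge0.
by rewrite expr2 expr0 !mulr1; lra.
Qed.

Variables (J : {fset I}) (G : I -> I -> R) (n : I -> int).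
Variables (S : nat -> I -> I -> bool) (L Kr Kc : R).
Hypotheses (d0 : (0 < d)%N) (L0 : 0 <= L).
Hypothesis GC : forall i j, G i j = G j i.
Hypothesis G_le : forall m i j, n i = n j + m%:Z ->
  `|G i j| <= L * rho ^+ (m * d) * (S m i j)%:R.
Hypothesis row_le : forall m i,
  \sum_(j <- J) (S m i j)%:R <= Kr * 2 ^+ (m * d.-1).
Hypothesis col_le : forall m j, \sum_(i <- J) (S m i j)%:R <= Kc.

(** Each pair is charged to its scale difference [m], coarser cube first. The row count
    [2 ^+ (m * d.-1)] cancels all of [rho ^+ (m * (2 * d).-1)] except [rho ^+ m], and the columns
    carry [rho ^+ m] as well, so both series have sum at most 4. *)
Lemma schur_le c : \sum_(i <- J) \sum_(j <- J) c i * c j * G i j <=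
  4 * L * (Kr + Kc) * \sum_(i <- J) c i ^+ 2.
Proof.
pose M := (\max_(i <- J) `|n i|%N).*2.+1.
pose E m i j := (c i ^+ 2 * rho ^+ (m * (2 * d).-1) + c j ^+ 2 * rho ^+ m) * (S m i j)%:R.
have r0 := @rho_gt0 R.
have E0 m i j : 0 <= E m i j.
  by rewrite /E mulr_ge0// addr_ge0// mulr_ge0 ?sqr_ge0// exprn_ge0// ltW.
have term m i j : n i = n j + m%:Z -> 2 * `|c i * c j * G i j| <= L * E m i j.
  move=> nij; rewrite !normrM.
  have := weighted_amgm `|c i| `|c j| d0 (exprn_ge0 m (ltW r0)).
  rewrite !real_normK ?num_real// -!exprM => h.
  apply: (@le_trans _ _ (2 * (`|c i| * `|c j| * (L * rho ^+ (m * d) * (S m i j)%:R)))).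
    by rewrite ler_wpM2l// ler_wpM2l ?mulr_ge0//; exact: G_le.
  rewrite (_ : 2 * _ = (2 * (`|c i| * `|c j| * rho ^+ (m * d))) * (L * (S m i j)%:R)); last by ring.
  by rewrite /E [leRHS]mulrCA ler_wpM2r// mulr_ge0.
(* Both orders appear because either cube may be the coarser one; the surplus terms are nonnegative.
   The factor 1/2 undoes the 2 of [weighted_amgm]. *)
have key i j : i \in J -> j \in J -> c i * c j * G i j <=
    2^-1 * L * \sum_(m < M) (E m i j + E m j i).
  move=> iJ jJ; have bnd k : k \in J -> (`|n k| <= \max_(i <- J) `|n i|)%N.
    by move=> kJ; apply: leq_bigmax_seq.
  have := bnd i iJ; have := bnd j jJ; set B := \big[_/_]_(_ <- _) _ => bj bi.
  have sumE m a b : (m < M)%N -> (a = i /\ b = j) \/ (a = j /\ b = i) ->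
      E m a b <= \sum_(m < M) (E m i j + E m j i).
    move=> mM; rewrite (bigD1 (Ordinal mM))//= => H.
    apply: (@le_trans _ _ (E m i j + E m j i)); last first.
      by rewrite lerDl sumr_ge0// => k _; rewrite addr_ge0.
    by case: H => -[-> ->]; rewrite ?lerDl ?lerDr.
  have [nij|/ltW nij] := leP (n j) (n i).
    pose m := `|n i - n j|%N.
    have mE : n i = n j + m%:Z by rewrite /m; lia.
    have mM : (m < M)%N by rewrite /m /M -/B; lia.
    have := term m i j mE; have := sumE m i j mM (or_introl (conj erefl erefl)).
    have := ler_norm (c i * c j * G i j) => h1 h2 h3.
    by have := ler_wpM2l L0 h2; lra.
  pose m := `|n j - n i|%N.
  have mE : n j = n i + m%:Z by rewrite /m; lia.
  have mM : (m < M)%N by rewrite /m /M -/B; lia.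
  have := term m j i mE; have := sumE m j i mM (or_intror (conj erefl erefl)).
  rewrite GC (mulrC (c j)) => h2 h3.
  have := ler_norm (c i * c j * G i j) => h1.
  by have := ler_wpM2l L0 h2; lra.
apply: (@le_trans _ _ (\sum_(i <- J) \sum_(j <- J) 2^-1 * L * \sum_(m < M) (E m i j + E m j i))).
  rewrite !big_seq; apply: ler_sum => i iJ.
  by rewrite big_seq [leRHS]big_seq; apply: ler_sum => j jJ; exact: key.
pose W := \sum_(i <- J) \sum_(j <- J) \sum_(m < M) E m i j.
have -> : \sum_(i <- J) \sum_(j <- J) 2^-1 * L * \sum_(m < M) (E m i j + E m j i) = L * W.
  under eq_bigr do rewrite -mulr_sumr; rewrite -mulr_sumr.
  rewrite (_ : \sum_(i <- J) _ = W + W); last first.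
    have {2}-> : W = \sum_(i <- J) \sum_(j <- J) \sum_(m < M) E m j i.
      by rewrite /W exchange_big.
    rewrite /W -big_split/=; apply: eq_bigr => i _.
    by rewrite -big_split/=; apply: eq_bigr => j _; rewrite big_split.
  by field.
rewrite (_ : 4 * L * _ * _ = L * (4 * (Kr + Kc) * \sum_(i <- J) c i ^+ 2)); last by ring.
rewrite ler_wpM2l//.
have pow2 m : rho ^+ (m * (2 * d).-1) * 2 ^+ (m * d.-1) = rho ^+ m.
  rewrite (_ : (m * (2 * d).-1 = 2 * (m * d.-1) + m)%N); last by case: d d0 => //= k _; nia.
  by rewrite exprD exprM rho_sqr mulrAC -exprMn mulVf// expr1n mul1r.
have WE : W = \sum_(m < M) ((\sum_(i <- J) c i ^+ 2 * rho ^+ (m * (2 * d).-1) * \sum_(j <- J) (S m i j)%:R)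
     + \sum_(j <- J) c j ^+ 2 * rho ^+ m * \sum_(i <- J) (S m i j)%:R).
  rewrite /W; under eq_bigr do rewrite exchange_big/=.
  rewrite exchange_big/=; apply: eq_bigr => m _.
  rewrite [X in _ = _ + X](_ : _ = \sum_(i <- J) \sum_(j <- J) c j ^+ 2 * rho ^+ m * (S m i j)%:R); last first.
    by rewrite exchange_big/=; apply: eq_bigr => j _; rewrite mulr_sumr.
  rewrite -big_split/=; apply: eq_bigr => i _.
  by rewrite mulr_sumr -big_split/=; apply: eq_bigr => j _; rewrite /E mulrDl.
have sq0 : 0 <= \sum_(i <- J) c i ^+ 2 by apply: sumr_ge0 => i _; rewrite sqr_ge0.
have step (m : 'I_M) : (\sum_(i <- J) c i ^+ 2 * rho ^+ (m * (2 * d).-1) * \sum_(j <- J) (S m i j)%:R)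
     + \sum_(j <- J) c j ^+ 2 * rho ^+ m * \sum_(i <- J) (S m i j)%:R <=
     (Kr + Kc) * (\sum_(i <- J) c i ^+ 2) * rho ^+ m.
  rewrite !mulrDl; apply: lerD.
    rewrite mulr_sumr mulr_suml; apply: ler_sum => i _.
    rewrite (_ : Kr * _ * _ = c i ^+ 2 * (Kr * rho ^+ m)); last by ring.
    rewrite -[X in _ * (Kr * X)]pow2 -mulrA ler_wpM2l ?sqr_ge0//.
    by rewrite [leRHS]mulrCA ler_wpM2l ?row_le// exprn_ge0// ltW.
  rewrite mulr_sumr mulr_suml; apply: ler_sum => i _.
  rewrite (_ : Kc * _ * _ = c i ^+ 2 * rho ^+ m * Kc); last by ring.
  by rewrite ler_wpM2l// mulr_ge0 ?sqr_ge0// exprn_ge0// ltW.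
(* The counting bounds force the signs of [Kr] and [Kc] only if [J] has an element, so the empty set
   is treated apart. *)
have Kc0 : J != fset0 -> 0 <= Kc.
  by case/fset0Pn => i _; apply: le_trans (col_le 0 i); apply: sumr_ge0.
have Kr0 : J != fset0 -> 0 <= Kr.
  case/fset0Pn => i _; have := row_le 0 i; rewrite mul0n expr0 mulr1.
  by apply: le_trans; apply: sumr_ge0.
have [J0|J0] := eqVneq J fset0.
  by rewrite /W J0 !big_seq_fset0 mulr0.
rewrite WE; apply: le_trans (ler_sum _ (fun m _ => step m)) _.
rewrite -mulr_sumr -[leRHS]mulrA mulrC ler_pM//.
- by apply: sumr_ge0 => m _; rewrite exprn_ge0// ltW.
- by rewrite mulr_ge0// addr_ge0 ?Kr0 ?Kc0.
- exact: sum_rho_le.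
Qed.

End schur_test.

Section residues.

(* Lattice points are counted by their residues, which determine them on
   ranges shorter than the modulus. *)
Definition residue (N : nat) (p : int) : nat := `|(p %% N)%Z|%N.

Lemma residue_lt N p : (0 < N)%N -> (residue N p < N)%N.
Proof.
move=> N0; rewrite /residue.
have := ltz_pmod p (_ : 0 < N%:Z)%R; rewrite ltz_nat => /(_ N0).
have := modz_ge0 p (_ : N%:Z != 0)%R; lia.
Qed.

Lemma residue_inj N p q : (0 < N)%N -> `|p - q| < N%:Z -> residue N p = residue N q -> p = q.
Proof.
move=> N0 pq; rewrite /residue => E.
have {}E : (p %% N)%Z = (q %% N)%Z.
  have := modz_ge0 p (_ : N%:Z != 0)%R; have := modz_ge0 q (_ : N%:Z != 0)%R; lia.
have := divz_eq p N; have := divz_eq q N; rewrite E.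
move: (p %/ N)%Z (q %/ N)%Z (q %% N)%Z => a b r hq hp.
have : `|(a - b) * N%:Z| < N%:Z by move: pq; rewrite hp hq; congr (`|_| < _); ring.
rewrite normrM [X in _ * X < _]gtr0_norm ?ltz_nat// => h.
rewrite -[X in (_ < X)%N]mul1n ltn_pmul2r// in h.
by rewrite hp hq (_ : a = b)//; lia.
Qed.

Lemma size_filter_le_card (T : finType) (I : eqType) (s : seq I) (P : pred I)
    (Q : {pred T}) (f : I -> T) : uniq s -> {in P, forall i, f i \in Q} ->
  {in P &, injective f} -> (count P s <= #|Q|)%N.
Proof.
move=> us PQ fi; rewrite -size_filter -(size_map f).
have uf : uniq (map f (seq.filter P s)).
  rewrite map_inj_in_uniq ?filter_uniq// => i j.
  by rewrite !mem_filter => /andP[iP _] /andP[jP _]; exact: fi.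
apply/card_geqP; exists (map f (seq.filter P s)); split=> //.
apply/allP; rewrite all_map; apply/allP => i /=.
by rewrite mem_filter => /andP[iP _]; exact: PQ.
Qed.

End residues.

(** * Gram matrix of the perturbations *)

Section perturbation_gram.
Context {R : realType} {d : nat}.
Local Notation mu := (@lebesgue_Rn R d).
Local Notation index := (dyadic_cube d * haar_index d)%type.
Variables (eta : R) (e : haar_index d -> {ffun 'I_d -> bool}).
Variables (A : dyadic_cube d -> haar_index d -> 'M[R]_d).
Variables (y : dyadic_cube d -> haar_index d -> 'cV[R]_d).
Hypotheses (e0 : 0 <= eta) (e1 : eta <= 4^-1).
Hypothesis near : forall Q k, near_identity eta (A Q k) (y Q k).
Hypothesis e_neq0 : forall k, exists i, e k i.
Implicit Types (i j : index).

Definition perturbation_profile i := perturbation (e i.2) (A i.1 i.2) (y i.1 i.2).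

Definition perturbation_atoms i : 'cV[R]_d -> R := atom i.1 (perturbation_profile i).

(* In the unit coordinates of the cube [i.1], the lower corner of the cube [j.1]
   when the latter is [m] scales smaller. *)
Definition base_point m i j : 'cV[R]_d :=
  \col_l (2^-1 ^+ m * (cube_offset m i.1 j.1 l 0)%:~R).

Lemma colB_entry (u v : 'cV[R]_d) l : (u - v) l 0 = u l 0 - v l 0.
Proof. by rewrite !mxE. Qed.

Lemma base_pointE m i j l :
  base_point m i j l 0 = 2^-1 ^+ m * (cube_offset m i.1 j.1 l 0)%:~R.
Proof. exact: mxE. Qed.

(* The functions [haar_unit s \o faces i b] for the two values of [b] are the
   two terms of [perturbation_profile i]. *)
Definition faces i (b : bool) : 'cV[R]_d -> 'cV[R]_d :=
  if b then near_affine (A i.1 i.2) (y i.1 i.2) else near_affine 1%:M 0.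

(** The small atom lives within [2 * 2^-1 ^+ m] of its base point, hence within 2, and the large
    profile on [[-1, 2)]; once an entry of the base point exceeds 6 in absolute value, the supports
    are disjoint. *)
Definition nearby m i j := (i.1.1 == j.1.1 + m%:Z) &&
  [forall l, `|base_point m i j l 0| <= 6].

(** The maps [faces] at most double distances, so 4 is twice the 2 that bounds the extent of the
    small atom around its base point. *)
Definition touches m i j (w : bool * 'I_d * 'I_3) :=
  `|faces i w.1.1 (base_point m i j) w.1.2 0 - threshold w.2| <= 4 * 2^-1 ^+ m.

Definition interacts m i j := nearby m i j && [exists w, touches m i j w].

Lemma near_affineB (B : 'M[R]_d) (v u u' : 'cV[R]_d) :
  near_affine B v u - near_affine B v u' = B *m (u - u').
Proof.
rewrite /near_affine opprD addrACA subrr add0r -mulmxBr; congr (_ *m _).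
by apply/colP => l; rewrite !mxE; ring.
Qed.

Lemma faces_lip i b (u v : 'cV[R]_d) (r : R) :
  (forall l, `|u l 0 - v l 0| <= r) ->
  forall l, `|faces i b u l 0 - faces i b v l 0| <= 2 * r.
Proof.
move=> uv l; have e1' : eta <= 1 by apply: le_trans e1 _; lra.
case: b => /=.
  exact: (near_affine_lip (near i.1 i.2) e1' uv).
exact: (near_affine_lip (near_identity1 e0) e1' uv).
Qed.

(* If the small cube stays away from the faces then the profile of the large
   cube is constant where the small atom, which has mean zero, lives. *)
Lemma ip_perturbation0 m i j : i.1.1 = j.1.1 + m%:Z -> ~~ interacts m i j ->
  ip mu (perturbation_atoms i) (perturbation_atoms j) = 0.
Proof.
move=> ij nij; have aj := perturbation_atom (e j.2) (near j.1 j.2) e1.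
have ai := perturbation_atom (e i.2) (near i.1 i.2) e1.
have h0 : 0 < (2^-1 : R) ^+ m by rewrite exprn_gt0.
have h1 : (2^-1 : R) ^+ m <= 1 by rewrite exprVn invf_le1 ?exprn_gt0// exprn_ege1// ler1n.
have close x : support_box (cube_coord j.1 x) -> forall l,
    `|cube_coord i.1 x l 0 - base_point m i j l 0| <= 2 * 2^-1 ^+ m.
  move=> sx l; rewrite (cube_coord_rescale _ ij) [base_point _ _ _ _ _]mxE -mulrBr addrK.
  rewrite normrM gtr0_norm// mulrC ler_pM2r// ler_norml.
  by have := sx l; lra.
have M0 := perturbation_mean0 (near j.1 j.2) e1 (e_neq0 j.2).
have [far|/forallPn[l]] := boolP [forall l, `|base_point m i j l 0| <= 6]; last first.
  rewrite -ltNge => far.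
  apply: (ip_atom_const (c := 0) aj M0) => x /(unit_atom_support aj)/close/(_ l) xl.
  have [_ /(_ (cube_coord i.1 x))] := ai.
  rewrite indicE memNset ?mulr0 ?normr_le0; first by move=> /eqP.
  by move=> /(_ l); move: xl far; rewrite ler_norml ltr_normr; lra.
move: nij; rewrite /interacts /nearby ij eqxx far/= => /existsPn nt.
apply: (ip_atom_const (c := perturbation_profile i (base_point m i j)) aj M0).
move=> x /(unit_atom_support aj) sx.
have cell b : same_cell (faces i b (cube_coord i.1 x)) (faces i b (base_point m i j)).
  move=> l k; have := nt (b, l, k); rewrite /touches/= -ltNge.
  have := faces_lip i b (close x sx) l; rewrite ler_norml ltr_normr.
  move=> h1' h2'; apply/idP/idP; lra.
have := cell false; rewrite /faces/= !near_affine1 => c0.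
rewrite /perturbation_profile /perturbation /perturbed_unit.
by rewrite (haar_unit_same_cell _ c0) (haar_unit_same_cell _ (cell true)).
Qed.

Lemma ip_perturbation_le m i j : i.1.1 = j.1.1 + m%:Z ->
  `|ip mu (perturbation_atoms i) (perturbation_atoms j)| <=
  2 * (@perturbation_constant R d * eta) * rho ^+ (m * d) * (interacts m i j)%:R.
Proof.
move=> ij; have aj := perturbation_atom (e j.2) (near j.1 j.2) e1.
have ai := perturbation_atom (e i.2) (near i.1 i.2) e1.
have [_|nij] := boolP (interacts m i j); last first.
  by rewrite (ip_perturbation0 ij nij) normr0 mulr0.
rewrite mulr1; apply: (ip_atom_le ai aj ij).
exact: perturbation_L1 (near j.1 j.2) e1.
Qed.

Lemma sum_bool_count (s : seq index) (P : pred index) :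
  \sum_(j <- s) (P j)%:R = (count P s)%:R :> R.
Proof. by rewrite -sum1_count natr_sum [RHS]big_mkcond; apply: eq_bigr => j _; case: (P j). Qed.

Lemma base_point_offset m i j l :
  (`|base_point m i j l 0| <= 6) -> `|cube_offset m i.1 j.1 l 0| <= 6 * 2 ^+ m.
Proof.
rewrite mxE; set p := cube_offset _ _ _ _ _ => h.
have h0 : 0 < (2 : R) ^+ m by rewrite exprn_gt0.
rewrite -(@ler_int R) intr_norm rmorphM/= rmorphXn/=.
move: h; rewrite normrM exprVn gtr0_norm ?invr_gt0// mulrC.
by rewrite ler_pdivrMr.
Qed.

(** Two larger cubes near [j] have offsets of size at most [6 * 2 ^+ m], which differ by [2 ^+ m]
    times the difference of their positions; positions thus differ by at most 12 and are told apart
    modulo 13. *)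
Lemma interacts_col m (s : seq index) j : uniq s ->
  (count (fun i => interacts m i j) s <= #|{: haar_index d}| * 13 ^ d)%N.
Proof.
move=> us; pose f i : haar_index d * {ffun 'I_d -> 'I_13} :=
  (i.2, [ffun l => Ordinal (residue_lt (i.1.2 l 0) (isT : 0 < 13)%N)]).
have -> : (#|{: haar_index d}| * 13 ^ d = #|{: haar_index d * {ffun 'I_d -> 'I_13}}|)%N.
  by rewrite card_prod card_ffun !card_ord.
apply: (size_filter_le_card (f := f)) => // i i' ii ii' [ek /ffunP ef].
move: ii ii'; rewrite !unfold_in => /andP[/andP[/eqP ij /forallP h] _].
move=> /andP[/andP[/eqP i'j /forallP h'] _].
case: i i' ek ef ij i'j h h' => -[n q] k [[n' q'] k'] /= -> ef ij i'j h h'.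
congr ((_, _), _); first by rewrite ij i'j.
apply/colP => l; have := ef l; rewrite !ffunE => /(congr1 val)/=.
apply: residue_inj => //.
have := base_point_offset (h l); have := base_point_offset (h' l).
rewrite !mxE/= => h1 h2.
have M0 : 0 < (2 : int) ^+ m by rewrite exprn_gt0.
have h3 : `|(q l 0 - q' l 0) * 2 ^+ m| <= 12 * 2 ^+ m.
  rewrite mulrBl ![_ * 2 ^+ m]mulrC; apply: le_trans (ler_distD (j.1.2 l 0) _ _) _.
  rewrite (distrC (2 ^+ m * q l 0)); apply: le_trans (lerD h2 h1) _.
  by rewrite -mulrDl mulrC.
move: h3; rewrite normrM [X in _ * X <= _]gtr0_norm// ler_pM2r// => h3; exact: le_lt_trans h3 _.
Qed.

(* The coordinates other than [l0] take [O(2 ^ m)] values each and, since the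
   [(l0, l0)] entry of the matrix is close to 1, they determine the remaining
   one up to [O(1)] choices when the cube touches the face [w]. *)
Lemma interacts_row1 m (s : seq index) i w : uniq s ->
  (count (fun j => nearby m i j && touches m i j w) s <=
   #|{: haar_index d}| * (13 ^ d * 2 ^ (m * d.-1)))%N.
Proof.
move=> us; case: w => [[b l0] k0].
have N0 : (0 < 13 * 2 ^ m)%N by rewrite muln_gt0 expn_gt0.
(* Offsets of absolute value at most [6 * 2 ^ m] are separated modulo [13 * 2 ^ m]. At [l0], two
   images within [4 * 2^-1 ^+ m] of one threshold differ by at most 8 units of [2^-1 ^+ m]; as
   [eta <= 4^-1], the base points differ by at most 32/3 < 11 units. *)
pose N l := (if l == l0 then 11 else 13 * 2 ^ m)%N.
have NN l : (0 < N l)%N by rewrite /N; case: ifP.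
have resN l p : (residue (N l) p < 13 * 2 ^ m)%N.
  apply: leq_trans (residue_lt _ (NN l)) _; rewrite /N; case: ifP => // _.
  by have := expn_gt0 2 m; lia.
pose f j : haar_index d * {ffun 'I_d -> 'I_(13 * 2 ^ m)} :=
  (j.2, [ffun l => Ordinal (resN l (cube_offset m i.1 j.1 l 0))]).
pose F l : pred 'I_(13 * 2 ^ m) := fun x => (x < N l)%N.
pose P : {pred haar_index d * {ffun 'I_d -> 'I_(13 * 2 ^ m)}} :=
  predX predT (family F).
have cF : (#|P| <= #|{: haar_index d}| * (13 ^ d * 2 ^ (m * d.-1)))%N.
  rewrite cardX leq_mul2l; apply/orP; right.
  rewrite card_family foldrE big_image/= (bigD1 l0)//=.
  have F0 : (#|F l0| <= 13)%N.
    rewrite -(card_in_imset (f := fun x : 'I_(13 * 2 ^ m) => inord x : 'I_13)).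
      by apply: leq_trans (max_card _) _; rewrite card_ord.
    move=> x x'; rewrite !unfold_in /N eqxx => xN xN' /(congr1 val).
    rewrite /= !inordK; first exact: val_inj.
      by apply: leq_trans xN' _.
    by apply: leq_trans xN _.
  have -> : (13 ^ d * 2 ^ (m * d.-1) = 13 * \prod_(l < d | l != l0) (13 * 2 ^ m))%N.
    rewrite prod_nat_const cardC1 card_ord expnMn -expnM mulnA -expnS prednK//.
    exact: leq_ltn_trans (ltn_ord l0).
  apply: leq_mul => //; apply: leq_prod => l _.
  by apply: leq_trans (max_card _) _; rewrite card_ord.
apply: leq_trans cF; apply: (size_filter_le_card (f := f)) => //.
  move=> j _; rewrite unfold_in /=; apply/forallP => l.
  rewrite ffunE unfold_in /F/=.
  exact: residue_lt.
move=> j j' jj jj' [ek /ffunP ef].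
move: jj jj'; rewrite !unfold_in => /andP[/andP[/eqP ij /forallP h] t].
move=> /andP[/andP[/eqP ij' /forallP h'] t'].
have off l : l != l0 -> cube_offset m i.1 j.1 l 0 = cube_offset m i.1 j'.1 l 0.
  move=> ll; have := ef l; rewrite !ffunE => /(congr1 val)/=.
  apply: residue_inj => //; rewrite /N (negbTE ll).
  have := base_point_offset (h l); have := base_point_offset (h' l).
  have : 0 < (2 : int) ^+ m by rewrite exprn_gt0.
  have -> : (13 * 2 ^ m)%N%:Z = 13 * 2 ^+ m :> int by rewrite PoszM -[Posz (2 ^ m)]natz natrX.
  clear; move: (cube_offset m i.1 j.1 l 0) (cube_offset m i.1 j'.1 l 0) (2 ^+ m).
  by move=> a a' M; lia.
have h0 : 0 < (2^-1 : R) ^+ m by rewrite exprn_gt0.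
pose w := base_point m i j - base_point m i j'.
pose B := if b then A i.1 i.2 else 1%:M.
have wdef l : w l 0 = 2^-1 ^+ m *
    (cube_offset m i.1 j.1 l 0 - cube_offset m i.1 j'.1 l 0)%:~R.
  by rewrite /w colB_entry !base_pointE rmorphB mulrBr.
(* The other offsets being equal, [w] is carried by coordinate [l0], so the matrix error there is at
   most [eta] times [|w l0 0|]. *)
have wE l : l != l0 -> w l 0 = 0 by move=> ll; rewrite wdef (off l ll) subrr mulr0.
have wr l : `|w l 0| <= `|w l0 0|.
  by have [->//|ll] := eqVneq l l0; rewrite wE// normr0.
have Bw : `|(B *m w) l0 0 - w l0 0| <= eta * `|w l0 0|.
  rewrite /B; case: (b); first exact: (near_identity_mul (near i.1 i.2) wr l0).
  exact: (near_identity_mul (near_identity1 e0) wr l0).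
have fB : (B *m w) l0 0 = faces i b (base_point m i j) l0 0 - faces i b (base_point m i j') l0 0.
  by rewrite /B /faces /w; case: (b); rewrite -colB_entry near_affineB.
have pp : `|w l0 0| < 11 * 2^-1 ^+ m.
  move: t t' Bw; rewrite /touches/= fB !ler_norml => t t' Bw.
  have : eta * `|w l0 0| <= 4^-1 * `|w l0 0| by rewrite ler_wpM2r.
  move: t t' Bw h0; clear; have [hw|hw] := ger0P (w l0 0); lra.
have off0 : cube_offset m i.1 j.1 l0 0 = cube_offset m i.1 j'.1 l0 0.
  have := ef l0; rewrite !ffunE => /(congr1 val)/=.
  apply: residue_inj => //; rewrite /N eqxx -(@ltr_int R) intr_norm.
  rewrite -(@ltr_pM2l _ (2^-1 ^+ m))// -[X in X * `|_|]gtr0_norm// -normrM -wdef.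
  by rewrite mulrC.
case: j j' ek ef ij ij' h h' t t' off w wdef wE wr Bw fB pp off0 => -[n q] k [[n' q'] k'] /=.
move=> -> _ ij ij' _ _ _ _ off _ _ _ _ _ _ _ off0.
congr ((_, _), _); first by apply: (addIr m%:Z); rewrite -ij.
apply/colP => l; have : cube_offset m i.1 (n, q) l 0 = cube_offset m i.1 (n', q') l 0.
  by have [->|/off] := eqVneq l l0.
by rewrite !mxE/= => /addIr.
Qed.

Lemma interacts_row m (s : seq index) i : uniq s ->
  (count (fun j => interacts m i j) s <=
   2 * d * 3 * #|{: haar_index d}| * 13 ^ d * 2 ^ (m * d.-1))%N.
Proof.
move=> us.
apply: (@leq_trans (\sum_w count (fun j => nearby m i j && touches m i j w) s)).
  rewrite -sum1_count; under [leqRHS]eq_bigr do rewrite -sum1_count big_mkcond.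
  rewrite exchange_big big_mkcond/=; apply: leq_sum => j _.
  case: ifP => // /andP[nij /existsP[w tw]].
  by rewrite (bigD1 w)//= nij tw.
apply: (@leq_trans (\sum_(w : bool * 'I_d * 'I_3) #|{: haar_index d}| * (13 ^ d * 2 ^ (m * d.-1)))).
  by apply: leq_sum => w _; exact: interacts_row1.
by rewrite sum_nat_const !card_prod card_bool !card_ord -!mulnA.
Qed.

Lemma perturbation_atoms_sqint i : sqint mu (perturbation_atoms i).
Proof. exact: atom_sqint (perturbation_atom (e i.2) (near i.1 i.2) e1). Qed.

(** 8 is the 4 of [schur_le] times the bound 2 for the perturbation; the bracket adds the row and
    column counts. *)
Definition bessel_constant : R := 8 * @perturbation_constant R d *
  ((2 * d * 3 * #|{: haar_index d}| * 13 ^ d)%:R + (#|{: haar_index d}| * 13 ^ d)%:R).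

Lemma bessel_perturbation : (0 < d)%N ->
  bessel mu perturbation_atoms (Num.sqrt (bessel_constant * eta)).
Proof.
move=> d0; split=> [|J c]; first exact: sqrtr_ge0.
have L0 : 0 <= 2 * (@perturbation_constant R d * eta).
  by rewrite !mulr_ge0.
have BC0 : 0 <= bessel_constant * eta by rewrite !(mulr_ge0, addr_ge0).
rewrite -sqrtrM// /nrm ler_wsqrtr//.
rewrite ip_combl; [|exact: perturbation_atoms_sqint|exact: sqint_comb perturbation_atoms_sqint].
rewrite (eq_bigr (fun i => \sum_(j <- J) c i * c j * ip mu (perturbation_atoms i) (perturbation_atoms j))); last first.
  move=> i _; rewrite ip_combr; [|exact: perturbation_atoms_sqint|exact: perturbation_atoms_sqint].
  by rewrite mulr_sumr; apply: eq_bigr => j _; rewrite mulrA.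
have uJ : uniq J by exact: fset_uniq.
have := @schur_le R _ d J (fun i j => ip mu (perturbation_atoms i) (perturbation_atoms j))
  (fun i => i.1.1) interacts _ (2 * d * 3 * #|{: haar_index d}| * 13 ^ d)%:R
  (#|{: haar_index d}| * 13 ^ d)%:R d0 L0 (fun i j => ipC _ _ _) ip_perturbation_le _ _ c.
rewrite (_ : 4 * _ * _ = bessel_constant * eta); last by rewrite /bessel_constant; ring.
apply.
  by move=> m i; rewrite sum_bool_count -natrX -natrM ler_nat interacts_row.
by move=> m j; rewrite sum_bool_count ler_nat interacts_col.
Qed.

End perturbation_gram.

(** * The Haar basis *)

Section density_measure.
Context {d0} {T : measurableType d0} {R : realType}.
Variables (mu : {measure set T -> \bar R}) (f : T -> R).
Hypotheses (mf : measurable_fun setT f) (f0 : forall x, 0 <= f x).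

(* The hypotheses are arguments so that the measure instance can be inferred. *)
Definition density (mf' : measurable_fun setT f) (f0' : forall x, 0 <= f x)
  (A : set T) : \bar R := (\int[mu]_(x in A) (f x)%:E)%E.

Let density0 : density mf f0 set0 = 0%E.
Proof. by rewrite /density integral_set0. Qed.

Let density_ge0 A : (0 <= density mf f0 A)%E.
Proof. by apply: integral_ge0 => x _; rewrite lee_fin. Qed.

Let density_sigma_additive : semi_sigma_additive (density mf f0).
Proof.
apply: semi_sigma_additive_nng_induced; first exact/measurable_EFinP.
by move=> x; rewrite lee_fin.
Qed.

HB.instance Definition _ := isMeasure.Build _ _ _ (density mf f0)
  density0 density_ge0 density_sigma_additive.

End density_measure.

(** * Functions with zero integral over every cube *)

Section cube_averages.
Context {R : realType} {d : nat}.
Local Notation mu := (@lebesgue_Rn R d).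
Implicit Types (Q : dyadic_cube d) (f : 'cV[R]_d -> R).

Definition cube_indic Q : 'cV[R]_d -> R := \1_(cube_set Q).

Lemma sqint_cube_indic Q : sqint mu (cube_indic Q).
Proof.
have mQ := @measurable_cube R d Q.
apply/sqintP; first exact: measurable_indic.
rewrite (eq_integral (fun x => (\1_(cube_set Q) x)%:E)) => [|x _]; last first.
  by rewrite /cube_indic indicE; case: (_ \in _); rewrite ?expr1n ?expr0n.
by rewrite integral_indic// setIT [X in (X < _)%E]lebesgue_cube ltry.
Qed.

Lemma integral_cube f Q : sqint mu f ->
  (\int[mu]_(x in cube_set Q) (f x)%:E = (ip mu f (cube_indic Q))%:E)%E.
Proof.
move=> sf; rewrite /ip /Rintegral fineK; last first.
  exact: integrable_fin_num (sqint_integrable sf (sqint_cube_indic Q)).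
rewrite [LHS]integral_mkcond; apply: eq_integral => x _.
by rewrite /patch /cube_indic indicE; case: (_ \in _); rewrite ?mulr1 ?mulr0.
Qed.

(** The positive and negative parts of [f] are densities of measures that agree on cubes, hence on
    all measurable sets. Where [f] is positive the second density vanishes, so the first has
    integral zero; symmetrically for the second. *)
Lemma nrm_eq0_cube f : sqint mu f ->
  (forall Q, ip mu f (cube_indic Q) = 0) -> nrm mu f = 0.
Proof.
move=> sf f0; have mf := sqint_measurable sf.
pose p x := Num.max (f x) 0; pose q x := Num.max (- f x) 0.
have mp : measurable_fun setT p by exact: measurable_maxr.
have mq : measurable_fun setT q.
  by apply: measurable_maxr => //; exact: measurableT_comp.
have p0 x : 0 <= p x by rewrite le_max lexx orbT.
have q0 x : 0 <= q x by rewrite le_max lexx orbT.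
have maxE x : p x = (if 0 < f x then f x else 0) /\ q x = if 0 < f x then 0 else - f x.
  rewrite /p /q; have [h|h] := ltP 0 (f x); split.
  - by [].
  - by apply/max_idPr; rewrite oppr_le0 ltW.
  - by [].
  - by apply/max_idPl; rewrite oppr_ge0.
have fpq x : `|f x| = p x + q x.
  have [-> ->] := maxE x; have [h|h] := ltP 0 (f x); last by rewrite ler0_norm// add0r.
  by rewrite gtr0_norm// addr0.
have fE : f = p - q.
  apply/funext => x; rewrite !fctE; have [-> ->] := maxE x.
  by case: ifP; rewrite ?subr0// sub0r opprK.
have sp : sqint mu p.
  by apply: (le_sqint mp sf) => x; rewrite ger0_norm// fpq lerDl.
have sq : sqint mu q.
  by apply: (le_sqint mq sf) => x; rewrite ger0_norm// fpq lerDr.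
have pq Q : density mu mp p0 (cube_set Q) = density mu mq q0 (cube_set Q).
  rewrite /density !integral_cube//; congr EFin; apply/eqP; rewrite -subr_eq0.
  by rewrite -ipBl ?sqint_cube_indic// -fE f0.
have poo Q : (density mu mp p0 (cube_set Q) < +oo)%E.
  by rewrite /density integral_cube// ltry.
have E := dyadic_measure_unique pq poo.
have vanish (g h : 'cV[R]_d -> R) (A : set 'cV[R]_d) :
    (forall x, ~ A x -> g x = 0) -> (forall x, A x -> h x = 0) ->
    (\int[mu]_(x in A) (g x)%:E = \int[mu]_(x in A) (h x)%:E)%E ->
    (\int[mu]_x (g x)%:E = 0)%E.
  move=> gA hA gh; rewrite [LHS](_ : _ = \int[mu]_(x in A) (g x)%:E)%E; last first.
    rewrite [RHS]integral_mkcond; apply: eq_integral => x _; rewrite /patch.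
    by case: ifPn => // /negP xA; rewrite gA// => /mem_set.
  rewrite gh; under eq_integral => x /set_mem xA do rewrite hA//.
  exact: integral0.
have mA : measurable [set x | 0 < f x].
  have := mf measurableT [set` `]0, +oo[] (measurable_itv _); rewrite setTI.
  by congr measurable; apply/seteqP; split=> x /=; rewrite in_itv/= andbT.
have mB : measurable [set x | f x < 0].
  have := mf measurableT [set` `]-oo, 0[] (measurable_itv _); rewrite setTI.
  by congr measurable; apply/seteqP; split=> x /=; rewrite in_itv.
have Ip : (\int[mu]_x (p x)%:E = 0)%E.
  apply: (vanish _ q _ _ _ (E _ mA)) => x /=.
    by move=> /negP/negbTE h; rewrite (maxE x).1 h.
  by move=> h; rewrite (maxE x).2 h.
have Iq : (\int[mu]_x (q x)%:E = 0)%E.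
  apply: (vanish _ p _ _ _ (esym (E _ mB))) => x /=.
    move=> /negP; rewrite -leNgt le_eqVlt (maxE x).2 => /predU1P[<-|->//].
    by rewrite ltxx oppr0.
  by move=> h; rewrite (maxE x).1 ltNge ltW.
have If : (\int[mu]_x `|(EFin \o f) x| = 0)%E.
  rewrite (eq_integral (fun x => (p x)%:E + (q x)%:E)%E) => [|x _].
    rewrite ge0_integralD// ?Ip ?Iq ?adde0//; try exact/measurable_EFinP.
      by move=> x _; rewrite lee_fin.
    by move=> x _; rewrite lee_fin.
  by rewrite /= fpq.
have /ae_eq_integral_abs : measurable_fun setT (EFin \o f) by exact/measurable_EFinP.
move=> /(_ mu measurableT)[/(_ If) ae0 _].
apply/eqP; rewrite -sqrf_eq0 sqr_nrm -eqe ip_EFin//; apply/eqP.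
rewrite (ge0_ae_eq_integral (g := cst 0%E) measurableT)//.
- by rewrite integral0.
- by apply/measurable_EFinP; exact: measurable_funX.
- by move=> x _; rewrite lee_fin sqr_ge0.
- by apply: filterS ae0 => x /(_ I)/=[-> _]; rewrite expr0n.
Qed.

End cube_averages.

Section haar_basis.
Context {R : realType} {d : nat}.
Local Notation mu := (@lebesgue_Rn R d).
Local Notation index := (dyadic_cube d * haar_index d)%type.
Variable e : haar_index d -> {ffun 'I_d -> bool}.
Hypothesis he : haar_enumeration e.
Implicit Types (i j : index) (Q : dyadic_cube d) (f : 'cV[R]_d -> R).

Definition haar_atoms i : 'cV[R]_d -> R := atom i.1 (haar_unit (e i.2)).

Lemma haar_enumeration_neq0 k : exists l, e k l.
Proof. by case: he => _ /(_ (e k))[+ _]; apply; exists k. Qed.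

Lemma haar_atoms_sqint i : sqint mu (haar_atoms i).
Proof. exact: atom_sqint (haar_unit_atom _). Qed.

Lemma haar_unit_mean0 (s : {ffun 'I_d -> bool}) : (exists l, s l) ->
  \int[mu]_x haar_unit s x = 0.
Proof.
move=> hs; have q0 : (0 : R) <= 4^-1 by [].
have := perturbed_unit_mean0 (near_identity1 (lexx 0)) q0 hs.
rewrite (_ : perturbed_unit _ _ _ = @haar_unit R d s)//.
by apply/funext => u; rewrite /perturbed_unit near_affine1.
Qed.

(** Across scales, the coarser function is constant on the finer cube. Distinct cubes of one scale
    are disjoint, and on a single cube the product is [haar_unit] of the symmetric difference of the
    patterns. *)
Lemma ip_haar_atoms_le i j : j.1.1 <= i.1.1 ->
  ip mu (haar_atoms i) (haar_atoms j) = (i == j)%:R.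
Proof.
case: i j => [[n q] k] [[n' q'] k'] /= le_n.
have aj := @haar_unit_atom R d (e k').
have mj := haar_unit_mean0 (haar_enumeration_neq0 k').
have [eqn|neqn] := eqVneq n n'; last first.
  rewrite (_ : _ == _ = false); last by apply: contraNF neqn => /eqP[->].
  have [m mE] : exists m : nat, n = n' + m.+1%:Z by exists `|n - n'|.-1%N; lia.
  pose u0 : 'cV[R]_d := \col_l (2^-1 ^+ m.+1 * (cube_offset m.+1 (n, q) (n', q') l 0)%:~R).
  apply: (ip_atom_const (c := haar_unit (e k) u0) aj mj) => x /haar_unit_support wx.
  apply: haar_unit_same_cell => l t.
  have E := @cube_coord_rescale R d m.+1 (n, q) (n', q') x mE l.
  rewrite E [u0 l 0]mxE /threshold; have := wx l.
  set w := cube_coord _ _ _ _; set p := cube_offset _ _ _ _ _ => /andP[w0 w1].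
  have h0 : 0 < (2 : R) ^+ m by rewrite exprn_gt0.
  (* The finer cube is at least one scale smaller, so multiplying by [2 ^+ m.+1] makes the
     thresholds integers, none of which falls strictly inside [[p, p + 1)]. *)
  have hE (z : R) : (2^-1 ^+ m.+1 * z < t%:R / 2) = (z < (2 ^+ m * (nat_of_ord t)%:Z)%:~R).
    rewrite exprVn (mulrC _ z) ltr_pdivrMr ?exprn_gt0// exprS rmorphM/= rmorphXn/=.
    by congr (z < _); field.
  rewrite !hE ltr_int -(ltrD2r 1) -lez1D -(@ler_int R) [1 + _]addrC.
  move: (2 ^+ m * _)%R => N.
  apply/idP/idP.
    move=> h; have : (p < N)%R by rewrite -(@ltr_int R); lra.
    by rewrite -lezD1 -(@ler_int R) rmorphD.
  by rewrite rmorphD/=; lra.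
case: n' / eqn le_n => _.
have [eqq|neqq] := eqVneq q q'; last first.
  rewrite (_ : _ == _ = false); last by apply: contraNF neqq => /eqP[->].
  apply: (ip_atom_const (c := 0) aj mj) => x /haar_unit_support wx.
  apply/eqP; apply: contraNT neqq => /haar_unit_support ux; apply/eqP/colP => l.
  have := wx l; have := ux l; rewrite !mxE/= => h1 h2.
  have h3 : (q l 0 < q' l 0 + 1)%R by rewrite -(@ltr_int R) rmorphD/=; lra.
  have h4 : (q' l 0 < q l 0 + 1)%R by rewrite -(@ltr_int R) rmorphD/=; lra.
  by apply/eqP; rewrite eq_le -!ltzD1 h3 h4.
case: q' / eqq => {aj mj}.
rewrite (ip_atom _ (haar_unit_atom _) (haar_unit_atom _)).
under eq_Rintegral do rewrite haar_unit_mul.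
have [eqk|neqk] := eqVneq k k'.
  rewrite eqk eqxx; transitivity (\int[mu]_x haar_unit [ffun=> false] x).
    apply: eq_Rintegral => x _; congr haar_unit.
    by apply/ffunP => l; rewrite !ffunE addbb.
  by rewrite haar_unit_integral0.
rewrite (_ : _ == _ = false); last by apply: contraNF neqk => /eqP[->].
apply: haar_unit_mean0; apply: contra_neqP neqk => /forallNP h.
case: he => inj _; apply: inj; apply/ffunP => l.
by have := h l; rewrite ffunE; case: (e k l); case: (e k' l).
Qed.

Lemma ip_haar_atoms i j : ip mu (haar_atoms i) (haar_atoms j) = (i == j)%:R.
Proof.
have [le_n|/ltW le_n] := leP j.1.1 i.1.1; first exact: ip_haar_atoms_le.
by rewrite ipC ip_haar_atoms_le// eq_sym.
Qed.

Lemma ip_comb_haar (J : {fset index}) (c : index -> R) j :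
  ip mu (comb J c haar_atoms) (haar_atoms j) = if j \in J then c j else 0.
Proof.
rewrite ip_combl; [|exact: haar_atoms_sqint|exact: haar_atoms_sqint].
case: ifPn => jJ; last first.
  rewrite big_seq big1// => i iJ; rewrite ip_haar_atoms.
  by have [ij|] := eqVneq i j; rewrite ?mulr0//; rewrite ij (negbTE jJ) in iJ.
rewrite (bigD1_seq j)//= ?fset_uniq// ip_haar_atoms eqxx mulr1.
by rewrite big1 ?addr0// => i /negbTE ij; rewrite ip_haar_atoms ij mulr0.
Qed.

Lemma bessel_haar : bessel mu haar_atoms 1.
Proof.
split=> // J c; rewrite mul1r /nrm ler_wsqrtr//.
rewrite {2}/comb ip_combr; [|exact: haar_atoms_sqint|exact: sqint_comb haar_atoms_sqint].
rewrite !big_seq; apply: ler_sum => i iJ.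
by rewrite ip_comb_haar iJ expr2.
Qed.

Definition parent_cube Q : dyadic_cube d := (Q.1 + 1, \col_l (Q.2 l ord0 %/ 2)%Z).

Lemma indic01_half (t : R) (b : bool) (X := \1_`[0, 1[ : R -> R) :
  X (2 * t - b%:R) = 2^-1 * X t + (if b then - 2^-1 else 2^-1) * haar01 t.
Proof.
rewrite /X /haar01 !indicE !mem_setE !in_itv/= subr_ge0 ltrBlDr.
case: b; rewrite /= ?mulr1n ?mulr0n.
  rewrite (_ : (1 <= 2 * t) = (2^-1 <= t)); last by apply/idP/idP; lra.
  rewrite (_ : (2 * t < 1 + 1) = (t < 1)); last by apply/idP/idP; lra.
  by have [h0|h0] := leP 0 t; have [h1|h1] := leP 2^-1 t; have [h2|h2] := leP 1 t;
    rewrite /= ?mulr1n ?mulr0n; lra.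
rewrite (_ : (0 <= 2 * t) = (0 <= t)); last by apply/idP/idP; lra.
rewrite (_ : (2 * t < 1 + 0) = (t < 2^-1)); last by apply/idP/idP; lra.
by have [h0|h0] := leP 0 t; have [h1|h1] := leP 2^-1 t; have [h2|h2] := leP 1 t;
  rewrite /= ?mulr1n ?mulr0n; lra.
Qed.

(** In each coordinate a cube is the left or right half of its parent, with indicator half that of
    the whole plus or minus half of [haar01]; expanding the product gives one term per pattern. *)
Lemma haar_unit0_parent Q : exists tau : {ffun 'I_d -> bool} -> R,
  tau [ffun=> false] = 2^-1 ^+ d /\
  forall x : 'cV[R]_d, haar_unit [ffun=> false] (cube_coord Q x) =
    \sum_s tau s * haar_unit s (cube_coord (parent_cube Q) x).
Proof.
pose odd_part l := (Q.2 l ord0 %% 2)%Z == 1.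
pose tau (s : {ffun 'I_d -> bool}) : R :=
  \prod_l (if s l then if odd_part l then - 2^-1 else 2^-1 else 2^-1).
exists tau; split.
  rewrite /tau (eq_bigr (fun=> 2^-1)) => [|l _]; last by rewrite ffunE.
  by rewrite prodr_const card_ord.
move=> x; set v := cube_coord (parent_cube Q) x.
have E l : cube_coord Q x l 0 = 2 * v l 0 - (odd_part l)%:R.
  have := @cube_coord_rescale R d 1 (parent_cube Q) Q x erefl l.
  rewrite -/v => ->; rewrite expr1 mulrA divff// mul1r.
  suff -> : cube_offset 1 (parent_cube Q) Q l ord0 = (odd_part l)%:R :> int.
    by case: (odd_part l); rewrite /= ?mulr1n ?mulr0n; ring.
  rewrite !mxE/= /odd_part expr1; have := divz_eq (Q.2 l 0) 2.
  have := modz_ge0 (Q.2 l 0) (isT : 2 != 0 :> int).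
  have := ltz_pmod (Q.2 l 0) (isT : 0 < 2 :> int).
  by case: eqP => /=; lia.
transitivity (\prod_l \sum_(b : bool)
    (if b then if odd_part l then - 2^-1 else 2^-1 else 2^-1) *
    (if b then haar01 (v l 0) else \1_`[0, 1[ (v l 0))).
  apply: eq_bigr => l _; rewrite ffunE E big_bool/= indic01_half addrC.
  by case: (odd_part l).
rewrite bigA_distr_bigA/=; apply: eq_bigr => s _.
by rewrite big_split.
Qed.

Lemma cube_weight_parent Q : cube_weight Q * 2^-1 ^+ d = rho ^+ d * cube_weight (parent_cube Q) :> R.
Proof.
have s0 := @cube_side_gt0 R d Q; have s'0 := @cube_side_gt0 R d (parent_cube Q).
have sE : cube_side (parent_cube Q) = 2 * cube_side Q :> R.
  by rewrite /cube_side expfzDr// mulrC.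
apply/eqP; rewrite -(@eqrXn2 _ 2)//; last 2 first.
- by rewrite mulr_ge0 ?cube_weight_ge0// exprn_ge0.
- by rewrite mulr_ge0 ?cube_weight_ge0// exprn_ge0// ltW// rho_gt0.
rewrite !exprMn ![cube_weight _ ^+ 2]sqr_sqrtr ?exprn_ge0 ?invr_ge0 ?ltW//.
rewrite !(exprAC _ d 2) rho_sqr -!exprMn; apply/eqP; congr (_ ^+ d).
by rewrite sE; field; rewrite gt_eqF.
Qed.

Lemma ip_parent r Q : sqint mu r -> (forall i, ip mu r (haar_atoms i) = 0) ->
  ip mu r (atom Q (haar_unit [ffun=> false])) =
  rho ^+ d * ip mu r (atom (parent_cube Q) (haar_unit [ffun=> false])).
Proof.
move=> sr r0; have [tau [tau0 tauE]] := haar_unit0_parent Q.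
pose P := parent_cube Q.
have w0 : cube_weight P != 0 :> R.
  have := @cube_weight_sqr R d P; apply: contra_eqN => /eqP ->.
  by rewrite expr0n mul0r eq_sym oner_eq0.
have sa s : sqint mu (atom P (haar_unit s)) by exact: atom_sqint (haar_unit_atom s).
have -> : atom Q (haar_unit [ffun=> false]) =
    \sum_s (cube_weight Q / cube_weight P * tau s) *: atom P (haar_unit s).
  apply/funext => x; rewrite fct_sumE /atom tauE mulr_sumr; apply: eq_bigr => s _.
  transitivity (cube_weight Q / cube_weight P * tau s *
    (cube_weight P * haar_unit s (cube_coord P x))) => //.
  by rewrite -/P; field.
rewrite ip_combr// (bigD1 [ffun=> false])//= tau0 big1 ?addr0 => [|s s0].
  by rewrite (mulrAC (cube_weight Q)) cube_weight_parent -/P; field.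
have [l sl] : exists l, s l.
  apply: contrapT => /forallNP h; case/eqP: s0; apply/ffunP => l.
  by rewrite ffunE; apply/negP/h.
have [_ /(_ s)[_ [|k <-]]] := he; first by exists l.
by rewrite -[atom _ _]/(haar_atoms (P, k)) r0 mulr0.
Qed.

Lemma nrm_atom_unit0 Q : nrm mu (atom Q (haar_unit [ffun=> false])) = 1.
Proof.
have a := @haar_unit_atom R d [ffun=> false].
rewrite /nrm (ip_atom Q a a) (eq_Rintegral _ (g := haar_unit [ffun=> false])).
  by rewrite haar_unit_integral0 sqrtr1.
move=> x _; rewrite haar_unit_mul; congr haar_unit.
by apply/ffunP => l; rewrite !ffunE.
Qed.

Lemma atom_unit0E Q (x : 'cV[R]_d) : atom Q (haar_unit [ffun=> false]) x = cube_weight Q * cube_indic Q x.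
Proof.
rewrite /atom /cube_indic indicE; congr (_ * _).
have [/set_mem/cube_setE h|h] := boolP (x \in cube_set Q).
  by rewrite /haar_unit big1// => l _; rewrite ffunE indicE mem_setE in_itv/= h.
apply/eqP; apply: contraNT h => /haar_unit_support h.
by apply: mem_set; apply/cube_setE.
Qed.

(* The inner products with the normalized indicators of a cube and of its
   parent differ by the factor [rho ^+ d], and all are at most [nrm mu r]. *)
Lemma haar_complete r : sqint mu r -> (forall i, ip mu r (haar_atoms i) = 0) ->
  (0 < d)%N -> nrm mu r = 0.
Proof.
move=> sr r0 d0; pose a Q := ip mu r (atom Q (haar_unit [ffun=> false])).
have sa Q : sqint mu (atom Q (haar_unit [ffun=> false])).
  exact: atom_sqint (haar_unit_atom _).
have bnd n Q : `|a Q| <= 2^-1 ^+ n * nrm mu r.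
  elim: n Q => [|n IH] Q.
    rewrite expr0 mul1r; apply: le_trans (cauchy_schwarz sr (sa Q)) _.
    by rewrite nrm_atom_unit0 mulr1.
  (* Two generations together gain [rho ^+ (2 * d) = 2^-1 ^+ d], at most 1/2 since [0 < d]. *)
  rewrite /a ip_parent// [X in _ * X]ip_parent// mulrA -expr2 normrM -exprM mulnC exprM rho_sqr.
  rewrite ger0_norm ?exprn_ge0// exprS -mulrA ler_pM ?exprn_ge0//; last exact: IH.
  by rewrite -[leRHS]expr1 ler_wiXn2l// invf_le1// ler1n.
have aE Q : a Q = 0.
  apply/eqP; rewrite -normr_eq0 eq_le normr_ge0 andbT leNgt; apply/negP => aQ.
  have n1 : 0 < nrm mu r + 1 by rewrite ltr_wpDl ?nrm_ge0.
  have [n hn] := pow_half_lt (divr_gt0 aQ n1).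
  have := bnd n Q; rewrite ltr_pdivlMr// mulrDr mulr1 in hn.
  have : 0 <= (2^-1 : R) ^+ n by rewrite exprn_ge0.
  lra.
apply: nrm_eq0_cube => // Q; have := aE Q; rewrite /a.
have -> : atom Q (haar_unit [ffun=> false]) = cube_weight Q *: cube_indic Q
    :> ('cV[R]_d -> R).
  by apply/funext => x; rewrite atom_unit0E.
rewrite ipZr ?sqint_cube_indic// => /eqP; rewrite mulf_eq0 => /orP[/eqP w0|/eqP//].
have := @cube_weight_sqr R d Q; rewrite w0 expr0n mul0r => /eqP.
by rewrite eq_sym oner_eq0.
Qed.

(** The Bessel property gives the series a sum [F]; [f - F] is orthogonal to every Haar function,
    hence null by [haar_complete]. *)
Lemma haar_expansion f : sqint mu f -> (0 < d)%N -> forall eps, 0 < eps ->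
  exists J0, forall J : {fset index}, (J0 `<=` J)%fset ->
    nrm mu (f - comb J (fun i => ip mu f (haar_atoms i)) haar_atoms) <= eps.
Proof.
move=> sf d0; set c := fun i => _.
have scomb J : sqint mu (comb J c haar_atoms) by exact: sqint_comb haar_atoms_sqint.
have cK (J : {fset index}) : \sum_(i <- J) c i ^+ 2 <= nrm mu f ^+ 2.
  have := bessel_dual J haar_atoms_sqint sf bessel_haar; rewrite mul1r -/c => h.
  rewrite -[leLHS]sqr_sqrtr ?lerXn2r ?nnegrE ?sqrtr_ge0 ?nrm_ge0//.
  by apply: sumr_ge0 => i _; rewrite sqr_ge0.
have [F sF HF] := bessel_synthesis haar_atoms_sqint bessel_haar cK.
have r0 j : ip mu (f - F) (haar_atoms j) = 0.
  apply/eqP; rewrite -normr_eq0 eq_le normr_ge0 andbT; apply/ler_addgt0Pl => eps eps0.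
  rewrite addr0; have [J0 HJ0] := HF _ eps0.
  (* Adjoining [j] makes the [j]-th coefficient of the partial sum exactly [c j]. *)
  pose J := (j |` J0)%fset; have := HJ0 J (fsubsetUr _ _).
  have -> : ip mu (f - F) (haar_atoms j) = - ip mu (F - comb J c haar_atoms) (haar_atoms j).
    rewrite !ipBl//; try exact: haar_atoms_sqint.
    by rewrite ip_comb_haar !inE eqxx/= opprB.
  rewrite normrN; apply: le_trans.
  apply: le_trans (cauchy_schwarz (sqintB sF (scomb J)) (haar_atoms_sqint j)) _.
  by rewrite [X in _ * X](_ : _ = 1) ?mulr1// /nrm ip_haar_atoms eqxx sqrtr1.
have n0 := haar_complete (sqintB sf sF) r0 d0.
move=> eps /HF[J0 HJ0]; exists J0 => J /HJ0; apply: le_trans.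
apply: le_trans (nrm_triangle sf sF (scomb J)) _.
by rewrite n0 add0r.
Qed.

End haar_basis.

(** * Reconstruction *)

Section real_reconstruction.
Context {R : realType} {d : nat}.
Local Notation mu := (@lebesgue_Rn R d).
Local Notation index := (dyadic_cube d * haar_index d)%type.
Variables (eta : R) (e : haar_index d -> {ffun 'I_d -> bool}).
Variables (A As : dyadic_cube d -> haar_index d -> 'M[R]_d).
Variables (y ys : dyadic_cube d -> haar_index d -> 'cV[R]_d).
Hypotheses (d_gt0 : (0 < d)%N) (e0 : 0 <= eta) (e1 : eta <= 4^-1).
Hypothesis he : haar_enumeration e.
Hypothesis near : forall Q k, near_identity eta (A Q k) (y Q k).
Hypothesis near_s : forall Q k, near_identity eta (As Q k) (ys Q k).

Definition perturbed_atoms (A' : dyadic_cube d -> haar_index d -> 'M[R]_d)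
    (y' : dyadic_cube d -> haar_index d -> 'cV[R]_d) (i : index) :=
  atom i.1 (perturbed_unit (e i.2) (A' i.1 i.2) (y' i.1 i.2)).

(** The error is [(2 + b) * b] with [b] the square root of [bessel_constant * eta]; in the first
    factor [eta] is bounded by 1. The added 1 ensures positivity. *)
Definition stability_constant : R :=
  (2 + Num.sqrt (@bessel_constant R d)) * Num.sqrt (@bessel_constant R d) + 1.

Lemma bessel_constant_ge0 : 0 <= @bessel_constant R d.
Proof. by rewrite /bessel_constant !(mulr_ge0, addr_ge0). Qed.

Lemma perturbed_atomsE A' y' i : perturbed_atoms A' y' i =
  haar_atoms e i + perturbation_atoms e A' y' i.
Proof. by apply/funext => x; rewrite /perturbed_atoms /atom !fctE -mulrDr addrC subrK. Qed.

Lemma perturbed_atoms_sqint A' y' : (forall Q k, near_identity eta (A' Q k) (y' Q k)) ->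
  forall i, sqint mu (perturbed_atoms A' y' i).
Proof. by move=> nr i; exact: atom_sqint (perturbed_unit_atom _ (nr _ _) e1). Qed.

Lemma bessel_perturbed A' y' : (forall Q k, near_identity eta (A' Q k) (y' Q k)) ->
  bessel mu (perturbed_atoms A' y') (1 + Num.sqrt (@bessel_constant R d * eta)).
Proof.
move=> nr; rewrite (_ : perturbed_atoms A' y' =
  fun i => haar_atoms e i + perturbation_atoms e A' y' i); last first.
  by apply/funext => i; exact: perturbed_atomsE.
apply: besselD => [i|i||]; first exact: haar_atoms_sqint.
- exact: (perturbation_atoms_sqint e e1 nr).
- exact: bessel_haar he.
- exact: (bessel_perturbation e0 e1 nr (haar_enumeration_neq0 he) d_gt0).
Qed.

Lemma real_reconstruction f : sqint mu f -> exists F,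
  [/\ sqint mu F,
      forall eps, 0 < eps -> exists J0, forall J : {fset index}, (J0 `<=` J)%fset ->
        nrm mu (F - comb J (fun i => ip mu f (perturbed_atoms A y i))
          (perturbed_atoms As ys)) <= eps &
      nrm mu (f - F) <= stability_constant * Num.sqrt eta * nrm mu f].
Proof.
move=> sf; set c := fun i : index => ip mu f (perturbed_atoms A y i); set hs := perturbed_atoms As ys.
pose b := Num.sqrt (@bessel_constant R d * eta).
have b0 : 0 <= b := sqrtr_ge0 _.
have sh : forall i, sqint mu (haar_atoms e i) by exact: haar_atoms_sqint.
have shs : forall i, sqint mu (hs i) := perturbed_atoms_sqint near_s.
have sg := perturbation_atoms_sqint e e1 near.
have sgs := perturbation_atoms_sqint e e1 near_s.
have Bhs : bessel mu hs (1 + b) := bessel_perturbed near_s.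
have Bg : bessel mu _ b := bessel_perturbation e0 e1 near (haar_enumeration_neq0 he) d_gt0.
have Bgs : bessel mu _ b := bessel_perturbation e0 e1 near_s (haar_enumeration_neq0 he) d_gt0.
have cK (J : {fset index}) : \sum_(i <- J) c i ^+ 2 <= ((1 + b) * nrm mu f) ^+ 2.
  have h := bessel_dual J (perturbed_atoms_sqint near) sf (bessel_perturbed near).
  rewrite -[leLHS]sqr_sqrtr; last by apply: sumr_ge0 => i _; rewrite sqr_ge0.
  by rewrite lerXn2r ?nnegrE ?sqrtr_ge0 ?mulr_ge0 ?addr_ge0 ?nrm_ge0.
have [F sF HF] := bessel_synthesis shs Bhs cK.
exists F; split=> //.
pose a i := ip mu f (haar_atoms e i); pose p i := ip mu f (perturbation_atoms e A y i).
(* The two error sums contribute [b] and [(1 + b) * b]. The decomposition is used on finite sums,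
   with a bound uniform in [J], before passing to the limit. *)
have main (J : {fset index}) :
    nrm mu (comb J a (haar_atoms e) - comb J c hs) <= (2 + b) * b * nrm mu f.
  have -> : comb J a (haar_atoms e) - comb J c hs =
      - (comb J a (perturbation_atoms e As ys) + comb J p hs).
    rewrite -opprB /comb -sumrB -big_split/=; congr (- _); apply: eq_bigr => i _.
    have -> : c i = a i + p i by rewrite /c perturbed_atomsE ipDr.
    rewrite scalerDl addrAC; congr (_ + _).
    by rewrite /hs perturbed_atomsE scalerDr addrC addKr.
  rewrite nrmN; apply: le_trans (nrmD (sqint_comb _ _ sgs) (sqint_comb _ _ shs)) _.
  have ha := bessel_dual J sh sf (bessel_haar he); rewrite mul1r in ha.
  have hp := bessel_dual J sg sf Bg.
  have := Bgs.2 J a; have := Bhs.2 J p.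
  rewrite -/(a _) in ha.
  move=> h1 h2; have h3 := ler_wpM2l b0 ha.
  have h4 : (1 + b) * Num.sqrt (\sum_(i <- J) p i ^+ 2) <= (1 + b) * (b * nrm mu f).
    by rewrite ler_wpM2l// addr_ge0.
  apply: le_trans (lerD (le_trans h2 h3) (le_trans h1 h4)) _.
  by rewrite le_eqVlt; apply/orP; left; apply/eqP; ring.
have bE : b = Num.sqrt (@bessel_constant R d) * Num.sqrt eta.
  by rewrite /b sqrtrM// bessel_constant_ge0.
have bB : b <= Num.sqrt (@bessel_constant R d).
  rewrite ler_wsqrtr// ler_piMr ?bessel_constant_ge0//.
  by apply: le_trans e1 _; lra.
have n0 := nrm_ge0 mu f.
suff : nrm mu (f - F) <= (2 + b) * b * nrm mu f.
  move=> /le_trans; apply; rewrite ler_wpM2r//.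
  apply: (@le_trans _ _ ((2 + Num.sqrt (@bessel_constant R d)) * b)).
    by rewrite ler_wpM2r// lerD2l.
  by rewrite bE mulrA ler_wpM2r ?sqrtr_ge0// lerDl.
apply/ler_addgt0Pl => eps eps0.
have eps2 : 0 < eps / 2 by rewrite divr_gt0.
have [J1 HJ1] := haar_expansion he sf d_gt0 eps2.
have [J2 HJ2] := HF _ eps2.
pose J := (J1 `|` J2)%fset.
have h1 := HJ1 J (fsubsetUl _ _); have h2 := HJ2 J (fsubsetUr _ _).
have sS := sqint_comb J a sh; have sSs := sqint_comb J c shs.
apply: le_trans (nrm_triangle sf sS sF) _.
rewrite nrmB in h2.
apply: le_trans (lerD h1 (le_trans (nrm_triangle sS sSs sF) (lerD (main J) h2))) _.
by rewrite addrCA -splitr addrC.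
Qed.

End real_reconstruction.

(** * Complex functions through real and imaginary parts *)

Section complex_L2.
Context {R : realType} {d : nat}.
Local Notation mu := (@lebesgue_Rn R d).
Implicit Types f g : 'cV[R]_d -> R[i].

Lemma norm2E f : sqint mu (fun x => complex.Re (f x)) ->
  sqint mu (fun x => complex.Im (f x)) ->
  norm2 f = (Num.sqrt (nrm mu (fun x => complex.Re (f x)) ^+ 2 +
                       nrm mu (fun x => complex.Im (f x)) ^+ 2))%:E.
Proof.
move=> su sv; rewrite /norm2 unlock /Lnorm.
rewrite (eq_integral (fun x => ((complex.Re (f x)) ^+ 2)%:E + ((complex.Im (f x)) ^+ 2)%:E)%E); last first.
  move=> x _; rewrite -EFinD /= powR_mulrn//; congr EFin.
  rewrite real_normK ?num_real//; case: (f x) => a b /=.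
  by rewrite sqr_sqrtr// addr_ge0// sqr_ge0.
rewrite ge0_integralD//; last 4 first.
- by move=> x _; rewrite lee_fin sqr_ge0.
- by apply/measurable_EFinP/measurable_funX; exact: sqint_measurable su.
- by move=> x _; rewrite lee_fin sqr_ge0.
- by apply/measurable_EFinP/measurable_funX; exact: sqint_measurable sv.
rewrite -(ip_EFin su) -(ip_EFin sv) -EFinD poweR_EFin powR12_sqrt ?addr_ge0 ?ip_ge0//.
by rewrite !sqr_nrm.
Qed.

Lemma L2P f : L2 f <-> sqint mu (fun x => complex.Re (f x)) /\
  sqint mu (fun x => complex.Im (f x)).
Proof.
split=> [[mu_ mv foo]|[su sv]]; last first.
  split; [exact: sqint_measurable su|exact: sqint_measurable sv|].
  by rewrite norm2E// ltry.
have mn : measurable_fun setT (fun x => Normc.normc (f x)).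
  rewrite (_ : (fun x => _) = fun x => Num.sqrt (complex.Re (f x) ^+ 2 + complex.Im (f x) ^+ 2)).
    apply: (measurableT_comp (f := @Num.sqrt R)).
      by apply: continuous_measurable_fun; exact: sqrt_continuous.
    by apply: measurable_funD; exact: measurable_funX.
  by apply/funext => x; case: (f x).
have sn : sqint mu (fun x => Normc.normc (f x)).
  rewrite /sqint inE; apply/andP; split; rewrite inE//=.
have le (a b : R) : `|a| <= `|Num.sqrt (a ^+ 2 + b ^+ 2)|.
  by rewrite [leRHS]ger0_norm ?sqrtr_ge0// -sqrtr_sqr ler_wsqrtr// lerDl sqr_ge0.
split; apply: (le_sqint _ sn) => // x; case: (f x) => a b //=.
by rewrite addrC.
Qed.

Lemma inner_realr f (h : 'cV[R]_d -> R) : inner f (fun x => (h x)%:C%C) =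
  Complex (ip mu (fun x => complex.Re (f x)) h) (ip mu (fun x => complex.Im (f x)) h).
Proof.
rewrite /inner /cintegral; congr Complex; apply: eq_Rintegral => x _;
  by case: (f x) => a b /=; ring.
Qed.

Lemma sqr_le_sqr (x z : R) : 0 <= x -> x <= z -> x ^+ 2 <= z ^+ 2.
Proof. by move=> x0 xz; rewrite lerXn2r// nnegrE (le_trans x0). Qed.

Lemma half_sqrD_le (t : R) : (t / 2) ^+ 2 + (t / 2) ^+ 2 <= t ^+ 2.
Proof. by have := sqr_ge0 t; rewrite !expr2; lra. Qed.

Lemma ReB (z w : R[i]) : complex.Re (z - w) = complex.Re z - complex.Re w.
Proof. by case: z; case: w. Qed.

Lemma ImB (z w : R[i]) : complex.Im (z - w) = complex.Im z - complex.Im w.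
Proof. by case: z; case: w. Qed.

Lemma sum_complex_real (I : choiceType) (J : {fset I}) (a b : I -> R)
    (h : I -> 'cV[R]_d -> R) x :
  \sum_(i <- J) Complex (a i) (b i) * (h i x)%:C%C =
  Complex (comb J a h x) (comb J b h x).
Proof.
rewrite /comb !fct_sumE; elim/big_rec3: _ => // i u v w _ ->.
transitivity (Complex (a i * h i x - b i * 0 + v) (a i * 0 + b i * h i x + u)) => //.
by rewrite !mulr0 subr0 add0r.
Qed.

End complex_L2.

Theorem corollary3 (R : realType) (d : nat) (d_ge1 : (1 <= d)%N) :
  exists c C : R, 0 < c /\ 0 < C /\
  forall (e : haar_index d -> {ffun 'I_d -> bool}), haar_enumeration e ->
  forall (eta : R), 0 <= eta <= c ->
  forall (A As : dyadic_cube d -> haar_index d -> 'M[R]_d)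
         (y ys : dyadic_cube d -> haar_index d -> 'cV[R]_d),
  (forall Q k, near_identity eta (A Q k) (y Q k)) ->
  (forall Q k, near_identity eta (As Q k) (ys Q k)) ->
  forall f : 'cV[R]_d -> R[i], L2 f ->
  exists fs : 'cV[R]_d -> R[i],
    [/\ L2 fs,
        unconditional_sum
          (fun (g : dyadic_cube d * haar_index d) x =>
             inner f (perturbed_haar g.1 (e g.2) (A g.1 g.2) (y g.1 g.2))
             * perturbed_haar g.1 (e g.2) (As g.1 g.2) (ys g.1 g.2) x)
          fs
      & (norm2 (fun x => (f x - fs x)%R) <= (C * Num.sqrt eta)%:E * norm2 f)%E].
Proof.
have d0 : (0 < d)%N by [].
exists 4^-1, (@stability_constant R d); split; first by rewrite invr_gt0.
have C0 : 0 < @stability_constant R d.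
  by rewrite /stability_constant ltr_wpDl// mulr_ge0 ?addr_ge0 ?sqrtr_ge0.
split=> // e he eta /andP[e0 e1] A As y ys near near_s f /L2P[su sv].
have [U [sU HU bU]] := real_reconstruction d0 e0 e1 he near near_s su.
have [V [sV HV bV]] := real_reconstruction d0 e0 e1 he near near_s sv.
set c := perturbed_atoms e A y in HU HV.
set h := perturbed_atoms e As ys in HU HV.
pose a i := ip (lebesgue_Rn d) (fun x => complex.Re (f x)) (c i).
pose b i := ip (lebesgue_Rn d) (fun x => complex.Im (f x)) (c i).
have sh i : sqint (lebesgue_Rn d) (h i) := perturbed_atoms_sqint e e1 near_s i.
exists (fun x => Complex (U x) (V x)); split.
- exact/L2P.
- rewrite /unconditional_sum.
  have NE (J : {fset dyadic_cube d * haar_index d}) :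
      norm2 (fun x => Complex (U x) (V x) - \sum_(g <- J)
        inner f (perturbed_haar g.1 (e g.2) (A g.1 g.2) (y g.1 g.2)) *
        perturbed_haar g.1 (e g.2) (As g.1 g.2) (ys g.1 g.2) x) =
      (Num.sqrt (nrm (lebesgue_Rn d) (U - comb J a h) ^+ 2 +
                 nrm (lebesgue_Rn d) (V - comb J b h) ^+ 2))%:E.
    have -> : (fun x => Complex (U x) (V x) - \sum_(g <- J)
        inner f (perturbed_haar g.1 (e g.2) (A g.1 g.2) (y g.1 g.2)) *
        perturbed_haar g.1 (e g.2) (As g.1 g.2) (ys g.1 g.2) x) =
      (fun x => Complex ((U - comb J a h) x) ((V - comb J b h) x)).
      apply/funext => x; rewrite -[RHS]/(Complex (U x) (V x) - Complex (comb J a h x) (comb J b h x)).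
      congr (_ - _); rewrite -sum_complex_real; apply: eq_bigr => g _.
      rewrite perturbed_haarE -inner_realr; congr (inner _ _ * _).
      by apply/funext => z; rewrite perturbed_haarE.
    by apply: norm2E; apply: sqintB => //; exact: sqint_comb sh.
  rewrite (_ : (fun J => _) = fun J : {fset dyadic_cube d * haar_index d} =>
      (Num.sqrt (nrm (lebesgue_Rn d) (U - comb J a h) ^+ 2 +
                 nrm (lebesgue_Rn d) (V - comb J b h) ^+ 2))%:E); last first.
    by apply/funext => J; exact: NE.
  have Ft := @summability.totally_filter (dyadic_cube d * haar_index d)%type.
  apply: cvg_EFin; first exact: nearW.
  apply/cvgrPdist_le => eps eps0.
  have eps2 : 0 < eps / 2 by rewrite divr_gt0.
  have [JU HJU] := HU _ eps2; have [JV HJV] := HV _ eps2.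
  exists (JU `|` JV)%fset => // J /= JJ.
  have h1 := HJU J (fsubset_trans (fsubsetUl _ _) JJ).
  have h2 := HJV J (fsubset_trans (fsubsetUr _ _) JJ).
  rewrite sub0r normrN ger0_norm ?sqrtr_ge0//.
  rewrite [leRHS](_ : eps = Num.sqrt (eps ^+ 2)); last by rewrite sqrtr_sqr gtr0_norm.
  apply: ler_wsqrtr.
  apply: (@le_trans _ _ ((eps / 2) ^+ 2 + (eps / 2) ^+ 2)).
    exact: (lerD (sqr_le_sqr (nrm_ge0 _ _) h1) (sqr_le_sqr (nrm_ge0 _ _) h2)).
  exact: half_sqrD_le.
- have ReE : (fun x => complex.Re (f x - Complex (U x) (V x))) =
      (fun x => complex.Re (f x)) - U by apply/funext => x; rewrite ReB.
  have ImE : (fun x => complex.Im (f x - Complex (U x) (V x))) =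
      (fun x => complex.Im (f x)) - V by apply/funext => x; rewrite ImB.
  rewrite !norm2E ?ReE ?ImE//; try exact: sqintB.
  rewrite -EFinM lee_fin; set K := stability_constant * _.
  have K0 : 0 <= K by rewrite mulr_ge0 ?sqrtr_ge0// ltW.
  (* With [K] under the root, the squared bounds for the real and imaginary parts add up, so the
     complex case costs no larger constant. *)
  rewrite -[X in X * _]ger0_norm// -sqrtr_sqr -sqrtrM ?sqr_ge0//.
  apply: ler_wsqrtr; rewrite mulrDr.
  rewrite -!exprMn.
  exact: (lerD (sqr_le_sqr (nrm_ge0 _ _) bU) (sqr_le_sqr (nrm_ge0 _ _) bV)).
Qed.
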